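(* Let $X$ be a closed smooth manifold and let $f:X\hookrightarrow\mathbb R^m$ be a smooth immersion. Then, for every $\epsilon>0$, there exists an immersion (actually an embedding) $f_\epsilon:X\hookrightarrow B^{16m^2+16m}(1)$ into the unit ball of $\mathbb R^{16m^2+16m}$ with $$curv^\perp\big(X\overset{f_\epsilon}{\hookrightarrow}B^{16m^2+16m}(1)\big)\le\sqrt{\frac{3m}{m+2}}+\epsilon.$$
   Context: $B^{M}(1)$ is the unit ball in $\mathbb R^{M}$. For a smooth immersion $f:X\hookrightarrow\mathbb R^M$, with $X$ carrying the induced Riemannian metric, $curv^\perp(X\overset{f}{\hookrightarrow}\mathbb R^M)$ is the supremum over all unit tangent vectors $\tau\in T(X)$ of $\|{\rm II}(\tau,\tau)\|$, where ${\rm II}$ is the second fundamental form; equivalently, the supremum of the Euclidean curvatures of the $f$-images of unit speed geodesics of $X$. Closed means compact without boundary. *)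

(* Defs.v *)
From HB Require Import structures.
From mathcomp Require Import all_boot all_order all_algebra.
From mathcomp Require Import all_classical all_reals all_analysis.
Import Order.TTheory GRing.Theory Num.Theory.
Import numFieldNormedType.Exports.

Set Implicit Arguments.
Unset Strict Implicit.
Unset Printing Implicit Defensive.

Local Open Scope classical_set_scope.
Local Open Scope ring_scope.

(* The canonical norm on ['rV[R]_n] is the sup norm: it has the right topology
   and the right derivatives, but metric notions need the Euclidean norm. *)
Definition enorm (R : realType) (n : nat) (u : 'rV[R]_n) : R :=
  Num.sqrt (\sum_(i < n) u ord0 i ^+ 2).

Definition unit_ball (R : realType) (n : nat) : set 'rV[R]_n :=
  [set u | enorm u <= 1].
Arguments unit_ball : clear implicits.

(* C^k on U; only meant for U open, so that the values of F outside of U do not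
   matter. *)
Fixpoint Ck_on (R : realType) (n m k : nat) (U : set 'rV[R]_n)
    (F : 'rV[R]_n -> 'rV[R]_m) : Prop :=
  match k with
  | 0 => forall p, U p -> {for p, continuous F}
  | k'.+1 => (forall p, U p -> differentiable F p) /\
             (forall v, Ck_on k' U ('D_v F))
  end.

Definition smooth_on (R : realType) (n m : nat) (U : set 'rV[R]_n)
    (F : 'rV[R]_n -> 'rV[R]_m) : Prop :=
  forall k, Ck_on k U F.

(* A homeomorphism from an open subset of X onto an open subset of R^n, the map
   and its inverse being extended arbitrarily to total functions. *)
Record chart (R : realType) (n : nat) (X : topologicalType) := Chart {
  chart_dom : set X;
  chart_map : X -> 'rV[R]_n;
  chart_inv : 'rV[R]_n -> X;
  chart_dom_open : open chart_dom;
  chart_cod_open : open (chart_map @` chart_dom);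
  chart_mapK : forall x, chart_dom x -> chart_inv (chart_map x) = x;
  chart_map_continuous : {within chart_dom, continuous chart_map};
  chart_inv_continuous :
    {within chart_map @` chart_dom, continuous chart_inv} }.

Definition chart_cod (R : realType) (n : nat) (X : topologicalType)
    (c : chart R n X) : set 'rV[R]_n :=
  chart_map c @` chart_dom c.

(* The atlas need not be maximal: any smooth atlas determines the structure.
   The carrier may be empty or disconnected. *)
Record smoothManifold (R : realType) (n : nat) := SmoothManifold {
  carrier :> topologicalType;
  atlas : set (chart R n carrier);
  manifold_hausdorff : hausdorff_space carrier;
  manifold_second_countable : @second_countable carrier;
  atlas_cover : forall x : carrier, exists2 c, atlas c & chart_dom c x;
  atlas_compatible : forall c d, atlas c -> atlas d ->
    smooth_on (chart_map c @` (chart_dom c `&` chart_dom d))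
              (chart_map d \o chart_inv c) }.

(* There is no boundary, since charts are onto open subsets of R^n. *)
Definition closed_manifold (R : realType) (n : nat)
    (X : smoothManifold R n) : Prop :=
  compact [set: X].

Section Immersions.
Variables (R : realType) (n m : nat) (X : smoothManifold R n).
Implicit Type f : X -> 'rV[R]_m.

Definition smooth_map f : Prop :=
  forall c, atlas c -> smooth_on (chart_cod c) (f \o chart_inv c).

Definition smooth_immersion f : Prop :=
  smooth_map f /\
  forall c p, atlas c -> chart_cod c p ->
    injective ('d (f \o chart_inv c) p).

(* An injective immersion whose inverse is continuous on its image. *)
Definition smooth_embedding f : Prop :=
  [/\ smooth_immersion f, injective f &
      forall U : set X, open U -> exists2 V, open V & U = f @^-1` V].

End Immersions.

(* The rows of ['J F p] span the tangent space of the immersion F at p, and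
   those of [kermx ('J F p)^T] its orthogonal complement: this is the
   orthogonal projection onto the normal space, acting on row vectors. *)
Definition normal_proj (R : realType) (n m : nat) (F : 'rV[R]_n -> 'rV[R]_m)
    (p : 'rV[R]_n) : 'M[R]_m :=
  proj_mx (kermx ('J F p)^T) <<'J F p>>%MS.

(* The second fundamental form at p of an immersion F of an open subset of R^n:
   the normal component of the Euclidean derivative, along dF(u), of the
   tangent field dF(v) with v constant. *)
Definition second_fundamental_form (R : realType) (n m : nat)
    (F : 'rV[R]_n -> 'rV[R]_m) (p u v : 'rV[R]_n) : 'rV[R]_m :=
  'D_u ('D_v F) p *m normal_proj F p.

(* Tangent vectors are given by their coordinates v in the charts of the atlas;
   they are unit vectors for the induced metric. If there are none
   (n = 0 or X empty), the supremum is -oo. *)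
Definition curv_perp (R : realType) (n m : nat) (X : smoothManifold R n)
    (f : X -> 'rV[R]_m) : \bar R :=
  ereal_sup [set k | exists c p v,
    [/\ atlas c, chart_cod c p, enorm ('d (f \o chart_inv c) p v) = 1 &
        k = (enorm (second_fundamental_form (f \o chart_inv c) p v v))%:E]].

(* Main.v *)
Require Import Defs.
From HB Require Import structures.
From mathcomp Require Import all_boot all_order all_algebra all_field.
From mathcomp Require Import all_classical all_reals all_analysis.
From mathcomp Require Import ring lra zify.
Import Order.TTheory GRing.Theory Num.Theory.
Import numFieldNormedType.Exports.

Set Implicit Arguments.
Unset Strict Implicit.
Unset Printing Implicit Defensive.

Local Open Scope classical_set_scope.
Local Open Scope ring_scope.

(** The map y |-> (a_i cos <s_i, y>, a_i sin <s_i, y>)_i from R^m to R^2N takes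
its values on the unit sphere if sum_i a_i^2 = 1. It is isometric if
sum_i a_i^2 <s_i, t>^2 = |t|^2, and then its second derivative in a unit
direction t has squared length sum_i a_i^2 <s_i, t>^4. The average of this over
the sphere is at least 3m/(m+2), with equality if all s_i have the same length,
so the best one can hope for is that this value is taken for all t.
[fourth_moment_design] finds such vectors with N <= 4m^2 + m: evaluating the
characters of F_q^2, with q a power of 2, at m points (x, x^3) gives vectors of
signs. Different pairs of distinct points have different sums here, so the fourth
moment is proportional to 3|t|^4 - 2 sum_j t_j^4, and the coordinate axes
compensate the diagonal term.

Compose this torus map with lam f for a large number lam. The second derivative
of the composition splits orthogonally into the one of the torus map and an
isometric copy of lam f'' ([torus_map_second_derivative]). As X is compact, |f''|
is at most a constant times |f'|^2 in suitable charts
([uniform_chart_bounds]), while the squared speed is lam^2 |f'|^2; thus the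
second part contributes O(1/lam) to the curvature. No other chart can give more:
a change of charts adds a tangent vector to a second derivative
([second_derive_other_chart]), and the normal component of a vector is its
shortest translate by tangent vectors ([enorm_normal_proj_le]).

Neither the torus map nor f needs to be injective, so this composition Phi need
not be an embedding. It leaves at least 2m + 1 coordinates free, which take
a small smooth map h that separates the points identified by Phi. Take any
smooth injection H of X into some R^K ([injective_smooth_map]), and let h be a
linear image of H in R^(2m+1). The pairs of distinct points with the same image
under Phi form a compact set, because Phi is locally injective. It has dimension
at most 2n <= 2m, whereas h fails to separate a pair only if 2m + 1 equations
hold: covering the pairs by small cells and counting integer matrices
shows that some matrix works for all cells ([separating_projection]). A final
homothety of ratio close to 1 puts the image into the unit ball. *)

(** * A spherical design of degree four *)

Section BinaryCharacters.
Variables (F : finFieldType) (F2 : 2%N \in [pchar F]).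

(** In any commutative ring
(x + y + u)^3 = x^3 + y^3 + u^3 + 3 (x + y) (y + u) (x + u), so in characteristic
2 the two equations force one of the three pairwise sums to vanish. *)
Lemma sidon_cubes (x y u v : F) :
  x + y + u + v = 0 -> x ^+ 3 + y ^+ 3 + u ^+ 3 + v ^+ 3 = 0 ->
  [\/ x = y /\ u = v, x = u /\ y = v | x = v /\ y = u].
Proof.
move=> s1; have addb (a b : F) : a + b = 0 -> a = b.
  by move/eqP; rewrite addr_eq0 oppr_pchar2 // => /eqP.
have := addb _ _ s1 => vE; rewrite -vE => s3.
have /eqP : (x + y) * ((y + u) * (x + u)) = 0.
  have t2 : 2%:R = 0 :> F by apply: pcharf0.
  rewrite -[LHS]addr0 -s3.
  (* The product plus the vanishing sum of cubes is a multiple of 2. *)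
  transitivity (2%:R * (x ^+ 3 + y ^+ 3 + u ^+ 3 + 2%:R *
    (x ^+2 * y + x^+2 * u + y^+2 * x + y ^+ 2 * u + u ^+ 2 * x + u ^+ 2 * y +
    2%:R * (x * y * u)))); last by rewrite t2 mul0r.
  ring.
rewrite !mulf_eq0 => /or3P[] /eqP /addb e; subst.
- by constructor 1; split=> //; rewrite addrr_pchar2 // add0r.
- by constructor 3; split=> //; rewrite -addrA addrr_pchar2 // addr0.
- by constructor 2; split=> //; rewrite addrAC addrr_pchar2 // add0r.
Qed.

(** A coordinate of F, seen as a vector space over F_2, at which the vector 1 does
not vanish. *)
Lemma binary_functional :
  exists2 psi : F -> bool, {morph psi : x y / x + y >-> x (+) y}
    & exists z, psi z.
Proof.
have [v2r v2r_lin /bij_inj v2r_inj] := pprimeChar_vectAxiom F2.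
have v2rD x y : v2r (x + y) = v2r x + v2r y.
  by have := v2r_lin 1 x y; rewrite !scale1r.
have v2r0 : v2r 0 = 0 by apply: (addrI (v2r 0)); rewrite -v2rD !addr0.
have : v2r 1 != 0 by rewrite -v2r0 (inj_eq v2r_inj) oner_neq0.
case/matrix0Pn=> i [j nz].
exists (fun x : F => v2r x i j != 0); last by exists 1.
move=> x y; rewrite v2rD mxE.
by case: (v2r x i j) => [[|[|//]] ?]; case: (v2r y i j) => [[|[|//]] ?].
Qed.

Variables (R : realType) (psi : F -> bool).
Hypotheses (psiD : {morph psi : x y / x + y >-> x (+) y}) (psi1 : exists z, psi z).

(** The characters of the additive group F x F; psi stands for a nonzero additive
map to F_2, so that every character has this form for exactly one a. *)
Definition binary_char (v a : F * F) : R := (-1) ^+ psi (a.1 * v.1 + a.2 * v.2).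

Lemma binary_charD u v a :
  binary_char (u + v) a = binary_char u a * binary_char v a.
Proof. by rewrite /binary_char !mulrDr addrACA psiD signr_addb. Qed.

Lemma binary_char_sum v :
  \sum_a binary_char v a = if v == 0 then (#|F| ^ 2)%:R else 0.
Proof.
have psi0 : psi 0 = false by have := psiD 0 0; rewrite addr0 addbb.
have [->|v0] := eqVneq v 0.
  under eq_bigr do rewrite /binary_char !mulr0 addr0 psi0 expr0.
  by rewrite sumr_const card_prod -mulnn.
have [b bP] : exists b : F * F, psi (b.1 * v.1 + b.2 * v.2).
  have [z zP] := psi1; case: v v0 => [p q] /=; rewrite xpair_eqE negb_and.
  case/orP=> nz; [exists (z / p, 0)|exists (0, z / q)] => /=;
    by rewrite divfK // mul0r ?addr0 ?add0r.
pose S := \sum_a binary_char v a; rewrite -/S.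
(* Translating the character by one that is -1 at v changes all signs. *)
have : S = - S.
  rewrite {1}/S (reindex_inj (addrI b)) /= -sumrN; apply: eq_bigr => a _.
  rewrite /binary_char /= !mulrDl addrACA psiD signr_addb bP expr1.
  by rewrite mulN1r.
by move=> SN; lra.
Qed.

End BinaryCharacters.

Lemma sum_kronecker (R : realType) (m : nat) (j : 'I_m) (G : 'I_m -> R) :
  \sum_k (j == k)%:R * G k = G j.
Proof.
rewrite (bigD1 j) //= eqxx mul1r big1 ?addr0 // => k kj.
by rewrite eq_sym (negbTE kj) mul0r.
Qed.

Lemma sum_expr4 (R : realType) (m : nat) (c : 'I_m -> R) :
  (\sum_j c j) ^+ 4 = \sum_j \sum_k \sum_l \sum_p c j * (c k * (c l * c p)).
Proof.
rewrite !exprS expr0 mulr1 mulr_suml; apply: eq_bigr => j _.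
rewrite mulr_suml mulr_sumr; apply: eq_bigr => k _.
rewrite mulr_suml !mulr_sumr; apply: eq_bigr => l _.
by rewrite !mulr_sumr.
Qed.

Section SidonMoments.
Variables (R : realType) (T : finType) (m : nat) (chi : 'I_m -> T -> R) (Q : R).
Hypothesis chi2 : forall j k,
  \sum_a chi j a * chi k a = (j == k)%:R * Q.
Hypothesis chi4 : forall j k l p,
  \sum_a chi j a * (chi k a * (chi l a * chi p a)) =
  [|| (j == k) && (l == p), (j == l) && (k == p) | (j == p) && (k == l)]%:R * Q.

(** [chi2] and [chi4] are the orthogonality relations of characters evaluated at the
points of a Sidon set in a group of exponent 2: a product of two or four of them
has a nonzero sum only if its indices can be matched in pairs. *)
Lemma sidon_second_moment (t : 'I_m -> R) :
  \sum_a (\sum_j chi j a * t j) ^+ 2 = Q * \sum_j t j ^+ 2.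
Proof.
under eq_bigr => a _ do rewrite expr2 mulr_suml.
rewrite exchange_big mulr_sumr; apply: eq_bigr => j _.
under eq_bigr => a _ do rewrite mulr_sumr.
rewrite exchange_big /=.
transitivity (\sum_k (j == k)%:R * (Q * (t j * t k))); last first.
  by rewrite sum_kronecker -expr2.
apply: eq_bigr => k _; rewrite mulrA -chi2 mulr_suml.
by apply: eq_bigr => a _; ring.
Qed.

Lemma sidon_fourth_moment (t : 'I_m -> R) :
  \sum_a (\sum_j chi j a * t j) ^+ 4 =
  Q * (3 * (\sum_j t j ^+ 2) ^+ 2 - 2 * \sum_j t j ^+ 4).
Proof.
under eq_bigr => a _ do rewrite sum_expr4.
rewrite exchange_big /=.
pose d (j k : 'I_m) : R := (j == k)%:R.
have dE j (G : 'I_m -> R) : \sum_k d j k * G k = G j by exact: sum_kronecker.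
(* Inclusion and exclusion for the three ways of matching four indices in pairs: the
     intersection of any two of them is the case of four equal indices. *)
transitivity (\sum_j \sum_k \sum_l \sum_p
   (d j k * (d l p * (Q * (t j * t k * t l * t p))) +
    d j l * (d k p * (Q * (t j * t k * t l * t p))) +
    d k l * (d j p * (Q * (t j * t k * t l * t p))) +
    d j k * (d j l * (d j p * (- 2 * Q * (t j * t k * t l * t p)))))).
  apply: eq_bigr => j _; rewrite exchange_big; apply: eq_bigr => k _ /=.
  rewrite exchange_big; apply: eq_bigr => l _ /=.
  rewrite exchange_big; apply: eq_bigr => p _ /=.
  transitivity ((\sum_a chi j a * (chi k a * (chi l a * chi p a))) *
     (t j * t k * t l * t p)).
    by rewrite mulr_suml; apply: eq_bigr => a _; ring.
  rewrite chi4 /d.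
  have [?|n1] := eqVneq j k; have [?|n2] := eqVneq l p;
  have [?|n3] := eqVneq j l; have [?|n4] := eqVneq k p;
  have [?|n5] := eqVneq j p; have [?|n6] := eqVneq k l; subst;
  rewrite ?eqxx /=; first [ring | by rewrite eqxx in n1 |
   by rewrite eqxx in n2 | by rewrite eqxx in n3 | by rewrite eqxx in n4 |
   by rewrite eqxx in n5 | by rewrite eqxx in n6].
pose S := \sum_j t j ^+ 2; rewrite -/S.
pose P := \sum_j t j ^+ 4; rewrite -/P.
have -> : Q * (3 * S ^+ 2 - 2 * P) =
  Q * S ^+ 2 + Q * S ^+ 2 + Q * S ^+ 2 - 2 * Q * P by ring.
have SS (G : 'I_m -> 'I_m -> R) : (forall j k, G j k = Q * (t j ^+2 * t k ^+ 2))
    -> \sum_j \sum_k G j k = Q * S ^+ 2.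
  move=> e; rewrite expr2 mulr_suml mulr_sumr; apply: eq_bigr => j _.
  by rewrite !mulr_sumr; apply: eq_bigr => k _.
under eq_bigr => j _ do under eq_bigr => k _ do under eq_bigr => l _ do
  rewrite !big_split -!mulr_sumr dE /=.
under eq_bigr => j _ do under eq_bigr => k _ do rewrite !big_split /=.
under eq_bigr => j _ do rewrite !big_split /=.
rewrite !big_split /=; congr (_ + _ + _ + _).
- transitivity (\sum_j \sum_k d j k * (Q * (t j * t k * S))).
    apply: eq_bigr => j _; apply: eq_bigr => k _.
    by rewrite -mulr_sumr /S !mulr_sumr; apply: eq_bigr => l _; ring.
  under eq_bigr => j _ do rewrite dE.
  by rewrite expr2 mulr_suml mulr_sumr; apply: eq_bigr => j _; ring.
- apply: etrans (SS (fun j k => Q * (t j ^+2 * t k ^+ 2)) _) => //.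
  apply: eq_bigr => j _; apply: eq_bigr => k _.
  by rewrite dE dE; ring.
- apply: etrans (SS (fun j k => Q * (t j ^+2 * t k ^+ 2)) _) => //.
  apply: eq_bigr => j _; apply: eq_bigr => k _; rewrite dE.
  by rewrite dE; ring.
- rewrite mulr_sumr -sumrN; apply: eq_bigr => j _.
  under eq_bigr => k _ do rewrite -mulr_sumr dE dE.
  by rewrite dE; ring.
Qed.
End SidonMoments.

(** Let q > m be the least power of 2. The q^2 sign vectors of the Sidon set get
the squared weight m / ((m + 2) q^2) each, and the m vectors sqrt m e_l get
2 / (m (m + 2)) each. This ratio makes the diagonal quartic terms cancel, and all
these vectors have length sqrt m, so that the first two moments are normalized
together. *)
Lemma fourth_moment_design (R : realType) (m : nat) : (0 < m)%N ->
  exists (N : nat) (a : 'I_N -> R) (s : 'I_N -> 'I_m -> R),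
  [/\ (N <= 4 * m ^ 2 + m)%N,
      \sum_i a i ^+ 2 = 1,
      forall t : 'I_m -> R,
        \sum_i a i ^+ 2 * (\sum_j s i j * t j) ^+ 2 = \sum_j t j ^+ 2 &
      forall t : 'I_m -> R,
        \sum_i a i ^+ 2 * (\sum_j s i j * t j) ^+ 4 =
        3 * m%:R / (m%:R + 2) * (\sum_j t j ^+ 2) ^+ 2].
Proof.
move=> m0; pose k := (trunc_log 2 m).+1.
have /andP[q1 q2] := trunc_log_bounds (isT : 1 < 2)%N m0.
have [F F2 cF] := pPrimePowerField (isT : prime 2) (isT : 0 < k)%N.
have [psi psiD psi1] := binary_functional F2.
have mF : (m <= #|F|)%N by rewrite cF ltnW.
pose z (j : 'I_m) : F := enum_val (widen_ord mF j).
have z_inj : injective z.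
  by move=> i j /enum_val_inj e; apply: val_inj; have := congr1 val e.
pose w (j : 'I_m) : F * F := (z j, z j ^+ 3).
pose chi (j : 'I_m) (c : F * F) : R := binary_char R psi (w j) c.
pose q : R := #|F|%:R.
have q0 : q != 0.
  by rewrite pnatr_eq0 -lt0n (leq_trans _ mF).
have addb (x y : F) : (x + y == 0) = (x == y).
  by rewrite addr_eq0 oppr_pchar2.
have chi2 j l : \sum_c chi j c * chi l c = (j == l)%:R * q ^+ 2.
  under eq_bigr => c _ do rewrite -binary_charD //.
  rewrite binary_char_sum // natrX -/q.
  have -> : (w j + w l == 0) = (j == l).
    apply/eqP/eqP => [/(congr1 fst) /eqP|->]; first by rewrite addb => /eqP /z_inj.
    by rewrite /w; congr (_, _); apply/eqP; rewrite addb.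
  by case: eqP; rewrite ?mul1r ?mul0r.
have chi4 j l p r : \sum_c chi j c * (chi l c * (chi p c * chi r c)) =
  [|| (j == l) && (p == r), (j == p) && (l == r) | (j == r) && (l == p)]%:R
   * q ^+ 2.
  under eq_bigr => c _ do rewrite -!binary_charD //.
  rewrite binary_char_sum // natrX -/q.
  have -> : (w j + (w l + (w p + w r)) == 0) =
    [|| (j == l) && (p == r), (j == p) && (l == r) | (j == r) && (l == p)].
    apply/eqP/idP => [e|].
      have := congr1 fst e; have := congr1 snd e; rewrite /= !addrA => e3 e1.
      by case: (sidon_cubes F2 e1 e3) => -[/z_inj -> /z_inj ->];
        rewrite !eqxx ?orbT.
    have ww i : w i + w i = 0 by congr (_, _); apply/eqP; rewrite addb.
    case/or3P => /andP[/eqP -> /eqP ->].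
    - by rewrite ww addr0 ww.
    - by rewrite [w r + _]addrCA ww addr0 ww.
    - by rewrite [w p + (w p + _)]addrA ww add0r ww.
  by case: ifP; rewrite ?mul1r ?mul0r.
pose I : finType := (F * F + 'I_m)%type.
pose M : R := m%:R; have M0 : 0 < M by rewrite ltr0n.
pose a (i : I) : R := match i with
  | inl _ => Num.sqrt (M / ((M + 2) * q ^+ 2))
  | inr _ => Num.sqrt (2 / (M * (M + 2))) end.
pose s (i : I) (j : 'I_m) : R := match i with
  | inl c => chi j c | inr l => (l == j)%:R * Num.sqrt M end.
have q20 : 0 < q ^+ 2 by rewrite lt_def sqr_ge0 expf_neq0.
have a2 i : a i ^+ 2 = match i with
  | inl _ => M / ((M + 2) * q ^+ 2) | inr _ => 2 / (M * (M + 2)) end.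
  by case: i => c /=; rewrite sqr_sqrtr // divr_ge0 // ?mulr_ge0 // ltW //;
    rewrite addr_gt0.
have Mn : M != 0 by rewrite gt_eqF.
have M2n : M + 2 != 0 by rewrite gt_eqF // addr_gt0.
have sumI (G : I -> R) :
    \sum_(i < #|I|) G (enum_val i) = \sum_c G (inl c) + \sum_l G (inr l).
  rewrite -(big_enum_val (A := predT) G).
  by rewrite big_sumType.
exists #|I|, (fun i => a (enum_val i)), (fun i => s (enum_val i)); split.
- rewrite card_sum card_prod card_ord leq_add2r cF.
  have : (2 ^ k <= 2 * m)%N by rewrite /k expnS leq_mul2l.
  nia.
- rewrite (sumI (fun i => a i ^+ 2)).
  under eq_bigr do rewrite a2; under [in X in _ + X]eq_bigr do rewrite a2.
  have sumc (T : finType) (y : R) : \sum_(x : T) y = #|T|%:R * y.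
    by rewrite sumr_const mulr_natl.
  rewrite !sumc card_prod card_ord natrM -/q -/M.
  by field; rewrite q0 Mn M2n.
- move=> t; rewrite (sumI (fun i => a i ^+ 2 * (\sum_j s i j * t j) ^+ 2)).
  under eq_bigr do rewrite a2; under [in X in _ + X]eq_bigr do rewrite a2.
  rewrite -!mulr_sumr /= (sidon_second_moment chi2).
  transitivity (M / ((M + 2) * q ^+ 2) * (q ^+ 2 * (\sum_j t j ^+ 2)) +
     2 / (M * (M + 2)) * \sum_l (M * t l ^+ 2)).
    congr (_ + _ * _); apply: eq_bigr => l _.
    under eq_bigr => j _ do rewrite -mulrA.
    by rewrite sum_kronecker exprMn sqr_sqrtr // ltW.
  by rewrite -mulr_sumr; field; rewrite q0 Mn M2n.
- move=> t; rewrite (sumI (fun i => a i ^+ 2 * (\sum_j s i j * t j) ^+ 4)).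
  under eq_bigr do rewrite a2; under [in X in _ + X]eq_bigr do rewrite a2.
  rewrite -!mulr_sumr /= (sidon_fourth_moment chi4).
  transitivity (M / ((M + 2) * q ^+ 2) * (q ^+ 2 *
     (3 * (\sum_j t j ^+ 2) ^+ 2 - 2 * \sum_j t j ^+ 4)) +
     2 / (M * (M + 2)) * \sum_l (M ^+ 2 * t l ^+ 4)).
    congr (_ + _ * _); apply: eq_bigr => l _.
    under eq_bigr => j _ do rewrite -mulrA.
    rewrite sum_kronecker exprMn; congr (_ * _).
    by rewrite -[in RHS](sqr_sqrtr (ltW M0)) -exprM.
  by rewrite -mulr_sumr -/M; field; rewrite q0 Mn M2n.
Qed.

(** * Euclidean norm and normal projection *)

Section EuclideanNorm.
Variables (R : realType) (n : nat).
Implicit Types u v : 'rV[R]_n.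

Lemma sum_sqr_ge0 u : 0 <= \sum_j u 0 j ^+ 2.
Proof. by apply: sumr_ge0 => j _; exact: sqr_ge0. Qed.

Lemma enorm_ge0 u : 0 <= enorm u. Proof. exact: sqrtr_ge0. Qed.

Lemma sqr_enorm u : enorm u ^+ 2 = \sum_j u 0 j ^+ 2.
Proof. by rewrite sqr_sqrtr ?sum_sqr_ge0. Qed.

Lemma enorm_le u (c : R) : 0 <= c -> (enorm u <= c) = (\sum_j u 0 j ^+ 2 <= c ^+ 2).
Proof. by move=> c0; rewrite -sqr_enorm ler_sqr ?nnegrE ?enorm_ge0. Qed.

Lemma enorm0_eq0 u : enorm u = 0 -> u = 0.
Proof.
move=> u0; apply/rowP => j; rewrite mxE.
have := sqr_enorm u; rewrite u0 expr0n /= => /esym/eqP.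
rewrite psumr_eq0 => [/allP/(_ j)|i _]; last exact: sqr_ge0.
by rewrite mem_index_enum => /(_ isT); rewrite sqrf_eq0 => /eqP.
Qed.

Lemma enorm0 : enorm (0 : 'rV[R]_n) = 0.
Proof. by rewrite /enorm big1 ?sqrtr0 // => j _; rewrite mxE expr0n. Qed.

Lemma enorm_coord u j : `|u 0 j| <= enorm u.
Proof.
rewrite -sqrtr_sqr ler_sqrt ?sum_sqr_ge0 // (bigD1 j) //= lerDl.
by apply: sumr_ge0 => i _; exact: sqr_ge0.
Qed.

Lemma enormZ (c : R) u : enorm (c *: u) = `|c| * enorm u.
Proof.
rewrite /enorm; under eq_bigr do rewrite mxE exprMn.
by rewrite -mulr_sumr sqrtrM ?sqr_ge0 // sqrtr_sqr.
Qed.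

Lemma Cauchy_Schwarz_row u v : \sum_j u 0 j * v 0 j <= enorm u * enorm v.
Proof.
set d := \sum_j _; have [/eqP v0|v0] := boolP (enorm v == 0).
  rewrite v0 mulr0 /d big1 // => j _.
  by rewrite (enorm0_eq0 v0) mxE mulr0.
apply: le_trans (ler_norm d) _.
rewrite -[leRHS]ger0_norm ?mulr_ge0 ?enorm_ge0 // -ler_sqr ?nnegrE //.
rewrite !real_normK ?num_real // exprMn !sqr_enorm.
have V0 : 0 < \sum_j v 0 j ^+ 2 by rewrite -sqr_enorm exprn_gt0 // lt_def v0 enorm_ge0.
set V := \sum_j v 0 j ^+ 2 in V0 *; set U := \sum_j _.
have : 0 <= \sum_j (V * u 0 j - d * v 0 j) ^+ 2.
  by apply: sumr_ge0 => j _; exact: sqr_ge0.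
have -> : \sum_j (V * u 0 j - d * v 0 j) ^+ 2 = V * (U * V - d ^+ 2).
  transitivity (\sum_j V ^+ 2 * u 0 j ^+ 2 + \sum_j (- 2 * V * d) * (u 0 j * v 0 j)
      + \sum_j d ^+ 2 * v 0 j ^+ 2).
    by rewrite -!big_split /=; apply: eq_bigr => j _; ring.
  by rewrite -!mulr_sumr -/U -/V -/d; ring.
by rewrite pmulr_rge0 // subr_ge0.
Qed.

Lemma enormD u v : enorm (u + v) <= enorm u + enorm v.
Proof.
rewrite enorm_le ?addr_ge0 ?enorm_ge0 // sqrrD !sqr_enorm.
under eq_bigr do rewrite mxE sqrrD.
rewrite 2!big_split /= lerD2r lerD2l sumrMnl lerMn2r /=.
exact: Cauchy_Schwarz_row.
Qed.

Lemma enorm_sum (I : Type) (r : seq I) (F : I -> 'rV[R]_n) :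
  enorm (\sum_(i <- r) F i) <= \sum_(i <- r) enorm (F i).
Proof.
elim: r => [|i r IH]; first by rewrite !big_nil enorm0.
by rewrite !big_cons (le_trans (enormD _ _)) // lerD2l.
Qed.

Lemma enorm_le_sum u : enorm u <= \sum_j `|u 0 j|.
Proof.
rewrite {1}[u]row_sum_delta; apply: le_trans (enorm_sum _ _) _.
apply: ler_sum => j _; rewrite enormZ -[leRHS]mulr1 ler_wpM2l //.
rewrite enorm_le // expr1n (bigD1 j) //= big1 => [|i ij].
  by rewrite mxE !eqxx expr1n addr0.
by rewrite mxE (negbTE ij) andbF expr0n.
Qed.

End EuclideanNorm.

Lemma sqr_enorm_row_mx (R : realType) (m1 m2 : nat) (u : 'rV[R]_m1) (v : 'rV[R]_m2) :
  enorm (row_mx u v) ^+ 2 = enorm u ^+ 2 + enorm v ^+ 2.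
Proof.
rewrite !sqr_enorm big_split_ord /=; congr (_ + _); apply: eq_bigr => j _.
  by rewrite row_mxEl.
by rewrite row_mxEr.
Qed.

Section NormalProjection.
Variables (R : realType) (n M : nat) (J : 'M[R]_(n, M)).
Let K := kermx J^T.

Lemma ker_tr_disjoint : (K :&: <<J>>)%MS = 0.
Proof.
apply/eqP; rewrite -submx0; apply/row_subP => i.
have := row_sub i (K :&: <<J>>)%MS; move: (row i _) => u.
rewrite sub_capmx genmxE => /andP[/sub_kermxP uJ /submxP[a ua]].
suff -> : u = 0 by exact: sub0mx.
have : enorm u ^+ 2 = 0.
  rewrite sqr_enorm; transitivity ((u *m u^T) 0 0).
    by rewrite mxE; apply: eq_bigr => j _; rewrite mxE expr2.
  by rewrite {2}ua trmx_mul mulmxA uJ mul0mx mxE.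
by move/eqP; rewrite sqrf_eq0 => /eqP/enorm0_eq0.
Qed.

Lemma ker_tr_full (w : 'rV[R]_M) : (w <= K + <<J>>)%MS.
Proof.
apply: submx_full; rewrite /row_full mxrank_disjoint_sum ?ker_tr_disjoint //.
by rewrite mxrank_ker genmxE mxrank_tr subnK // rank_leq_col.
Qed.

(** The projection of w + a J onto the orthogonal complement of the row space of J is
that of w, and an orthogonal projection does not increase lengths. *)
Lemma enorm_normal_proj_le (w : 'rV[R]_M) (a : 'rV[R]_n) :
  enorm (w *m proj_mx K <<J>>%MS) <= enorm (w + a *m J).
Proof.
rewrite -[in leRHS](add_proj_mx ker_tr_disjoint (ker_tr_full w)) -addrA.
have /sub_kermxP xJ := proj_mx_sub K <<J>>%MS w.
have : (w *m proj_mx <<J>>%MS K <= J)%MS.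
  by have := proj_mx_sub <<J>>%MS K w; rewrite genmxE.
case/submxP => b ->; rewrite -mulmxDl.
move: (w *m _) xJ => x xJ.
have [y yE] : exists y, y = (b + a) *m J by exists ((b + a) *m J).
rewrite -yE.
rewrite enorm_le ?enorm_ge0 // sqr_enorm.
under [leRHS]eq_bigr do rewrite mxE sqrrD -addrA.
rewrite big_split /= lerDl big_split /= sumrMnl.
suff -> : \sum_j x 0 j * y 0 j = 0 by rewrite mul0rn add0r; exact: sum_sqr_ge0.
transitivity ((x *m y^T) 0 0).
  by rewrite mxE; apply: eq_bigr => j _; rewrite mxE.
by rewrite yE trmx_mul mulmxA xJ mul0mx mxE.
Qed.

End NormalProjection.

(** * Functions of class C^k *)

Section Germs.
Variables (R : realType) (V W : normedModType R).

(** Differentiability is a property of germs; a vanishing germ is the case from which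
the others follow by adding a function. *)
Lemma near0_differentiable (f : V -> W) (p : V) :
  (\near p, f p = 0) -> differentiable f p.
Proof.
move=> f0; have fp : f p = 0 by exact: nbhs_singleton f0.
have fo : f \o shift p = cst (f p) + (\0 : V -> W) +o_ 0 id.
  apply/eqaddoE; rewrite addr0 funeqE => h /=; rewrite fp /= add0r.
  rewrite littleoE // => _/posnumP[e]; near=> k => /=.
  suff -> : f (k + p) = 0 by rewrite normr0 mulr_ge0.
  by near: k; move: f0; rewrite (near_shift 0) subr0; apply: filterS => h'.
have df0 : 'd f p = (\0 : V -> W) :> (V -> W).
  by apply: diff_unique => // x; exact: cst_continuous.
by apply/diff_locallyP; rewrite df0; split=> // x; exact: cst_continuous.
Unshelve. all: by end_near. Qed.

Lemma near_eq_differentiable (f g : V -> W) (p : V) :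
  (\near p, f p = g p) -> differentiable f p -> differentiable g p.
Proof.
move=> fg df; have -> : g = f + (g - f) by rewrite addrC subrK.
apply: differentiableD => //; apply: near0_differentiable.
by apply: filterS fg => q e; rewrite !fctE /= e subrr.
Qed.

Lemma near_eq_continuous (f g : V -> W) (p : V) :
  (\near p, f p = g p) -> {for p, continuous f} -> {for p, continuous g}.
Proof.
move=> fg fc; rewrite /prop_for /continuous_at -(nbhs_singleton fg).
by apply: cvg_trans fc; apply: near_eq_cvg; apply: filterS fg => q ->.
Qed.

End Germs.

Section RowFunctions.
Variables (R : realType) (V : normedModType R).

Lemma differentiable_rowP m (F : V -> 'rV[R]_m) (p : V) :
  differentiable F p <-> forall j, differentiable (fun x => F x 0 j) p.
Proof.
split=> [dF j|dF].
  exact: (differentiable_comp dF (differentiable_coord _ _ _)).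
have -> : F = \sum_(j < m) (fun x => F x 0 j *: 'e_j).
  by apply/funext => x; rewrite fct_sumE {1}[F x]row_sum_delta.
by apply: differentiable_sum => j; exact: differentiableZl.
Qed.

Lemma derive_row m (F : V -> 'rV[R]_m) (p v : V) j : differentiable F p ->
  ('D_v F p) 0 j = 'D_v (fun x => F x 0 j) p.
Proof. by move=> dF; rewrite derive_mx ?mxE //; exact: diff_derivable. Qed.

Lemma continuous_rowP (T : topologicalType) m (F : T -> 'rV[R]_m) (p : T) :
  {for p, continuous F} <-> forall j, {for p, continuous (fun x => F x 0 j)}.
Proof.
split=> [cF j|cF].
  apply: (@continuous_comp _ _ _ F (fun u : 'rV[R]_m => u 0 j)) => //.
  exact: coord_continuous.
have -> : F = fun x => \sum_(j < m) F x 0 j *: 'e_j.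
  by apply/funext => x; rewrite {1}[F x]row_sum_delta.
rewrite /prop_for /continuous_at.
apply: cvg_big => [|j _]; first exact: add_continuous.
by apply: cvgZr_tmp; exact: cF.
Qed.

End RowFunctions.

Section PartialDerivatives.
Variables (R : realType).

Lemma derive_partials n (W : normedModType R) (f : 'rV[R]_n -> W) (p v : 'rV[R]_n) :
  differentiable f p -> 'D_v f p = \sum_(j < n) v 0 j *: 'D_'e_j f p.
Proof.
move=> df; rewrite deriveE // {1}[v]row_sum_delta linear_sum.
by apply: eq_bigr => j _; rewrite linearZ deriveE.
Qed.

Lemma derive_comp_partials n m (F : 'rV[R]_n -> 'rV[R]_m) (G : 'rV[R]_m -> R)
    (p v : 'rV[R]_n) : differentiable F p -> differentiable G (F p) ->
  'D_v (G \o F) p = \sum_(j < m) 'D_v (fun x => F x 0 j) p * 'D_'e_j G (F p).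
Proof.
move=> dF dG; rewrite deriveE; last exact: differentiable_comp.
rewrite diff_comp //= -deriveE // -deriveE // (derive_partials _ dG).
by apply: eq_bigr => j _; rewrite derive_row.
Qed.

End PartialDerivatives.

Section ScalarCk.
Variables (R : realType) (n : nat).
Implicit Types (U V : set 'rV[R]_n) (f g : 'rV[R]_n -> R).

(** The scalar analogue of [Ck_on]: by [Ck_onP] a map is of class C^k exactly when
its coordinates are, and scalar functions can be multiplied. *)
Fixpoint Ck (k : nat) U f : Prop :=
  match k with
  | 0 => forall p, U p -> {for p, continuous f}
  | k'.+1 => (forall p, U p -> differentiable f p) /\
             (forall v, Ck k' U ('D_v f))
  end.

Lemma open_near U (P : 'rV[R]_n -> Prop) p :
  open U -> U p -> (forall q, U q -> P q) -> \near p, P p.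
Proof. by move=> oU Up UP; apply: filterS UP (open_nbhs_nbhs _). Qed.

(** U has to be open: the derivatives at a point of U see the values of the function
on a neighbourhood. *)
Lemma Ck_ext k U f g : open U -> (forall p, U p -> f p = g p) ->
  Ck k U f -> Ck k U g.
Proof.
move=> oU; elim: k f g => [|k IH] f g fg /=.
  move=> fc p Up; apply: near_eq_continuous (fc _ Up).
  exact: open_near Up fg.
move=> [df Df]; split=> [p Up|v].
  by apply: near_eq_differentiable (df _ Up); exact: open_near Up fg.
apply: IH (Df v) => p Up; apply: near_eq_derive; exact: open_near Up fg.
Qed.

Lemma Ck_local k U f :
  (forall p, U p -> exists2 V, V p & Ck k V f) -> Ck k U f.
Proof.
elim: k f => [|k IH] f /= loc.
  by move=> p /loc [V Vp]; exact.
split=> [p /loc [V Vp []]|v]; first by move=> df _; exact: df.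
by apply: IH => p /loc [V Vp [_]] Df; exists V.
Qed.

Lemma CkS k U f : Ck k.+1 U f -> Ck k U f.
Proof.
elim: k f => [|k IH] f [df Df] /=.
  by move=> p Up; apply: differentiable_continuous; exact: df.
by split=> // v; apply: IH; exact: Df.
Qed.

Lemma Ck_cst k U (a : R) : Ck k U (cst a).
Proof.
elim: k a => [|k IH] a /=; first by move=> p _; exact: cst_continuous.
split=> [p _|v]; first exact: differentiable_cst.
have -> : 'D_v (cst a : 'rV[R]_n -> R) = cst 0.
  by apply/funext => p; rewrite derive_cst.
exact: IH.
Qed.

Lemma CkD k U f g : open U -> Ck k U f -> Ck k U g -> Ck k U (f + g).
Proof.
move=> oU; elim: k f g => [|k IH] f g /=.
  by move=> fc gc p Up; apply: continuousD; [exact: fc|exact: gc].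
move=> [df Df] [dg Dg]; split=> [p Up|v].
  by apply: differentiableD; [exact: df|exact: dg].
apply: Ck_ext (IH _ _ (Df v) (Dg v)) => // p Up.
by rewrite fctE -deriveD //; apply: diff_derivable; [exact: df|exact: dg].
Qed.

Lemma CkM k U f g : open U -> Ck k U f -> Ck k U g -> Ck k U (f * g).
Proof.
move=> oU; elim: k f g => [|k IH] f g /=.
  by move=> fc gc p Up; apply: continuousM; [exact: fc|exact: gc].
move=> Hf Hg; have [df Df] := Hf; have [dg Dg] := Hg.
split=> [p Up|v]; first by apply: differentiableM; [exact: df|exact: dg].
have := CkD oU (IH _ _ (CkS Hf) (Dg v)) (IH _ _ (CkS Hg) (Df v)).
apply: Ck_ext => // p Up; rewrite !fctE deriveM //.
- by apply: diff_derivable; exact: df.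
- by apply: diff_derivable; exact: dg.
Qed.

Lemma Ck_sum k U (I : Type) (r : seq I) (f : I -> 'rV[R]_n -> R) : open U ->
  (forall i, Ck k U (f i)) -> Ck k U (fun x => \sum_(i <- r) f i x).
Proof.
move=> oU Cf; elim: r => [|i r IH].
  by apply: Ck_ext (Ck_cst k U 0) => // p _; rewrite big_nil.
by apply: Ck_ext (CkD oU (Cf i) IH) => // p _; rewrite big_cons.
Qed.

Lemma CkZ k U (a : R) f : open U -> Ck k U f -> Ck k U (fun x => a * f x).
Proof. by move=> oU Cf; exact: (CkM oU (Ck_cst k U a) Cf). Qed.

Lemma Ck_coord k U j : Ck k U (fun x : 'rV[R]_n => x 0 j).
Proof.
case: k => [|k] /=; first by move=> p _; exact: coord_continuous.
split=> [p _|v]; first exact: differentiable_coord.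
have -> : 'D_v (fun x : 'rV[R]_n => x 0 j) = cst (v 0 j).
  apply/funext => p; rewrite -(derive_row (F := id)) ?derive_id //.
exact: Ck_cst.
Qed.

End ScalarCk.

Section ComposedCk.
Variables (R : realType) (n : nat).

(** Induction on k, as the derivative of G o F is a sum of products of derivatives of
F with partial derivatives of G composed with F. *)
Lemma Ck_comp m k (U : set 'rV[R]_n) (V : set 'rV[R]_m)
    (F : 'rV[R]_n -> 'rV[R]_m) (G : 'rV[R]_m -> R) : open U -> open V ->
  (forall p, U p -> V (F p)) -> (forall j, Ck k U (fun x => F x 0 j)) ->
  Ck k V G -> Ck k U (G \o F).
Proof.
move=> oU oV UV; elim: k G => [|k IH] G.
  move=> CF CG p Up; apply: continuous_comp; last exact/CG/UV.
  by apply/continuous_rowP => j; exact: CF.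
move=> CF [dG DG].
have dF p : U p -> differentiable F p.
  by move=> Up; apply/differentiable_rowP => j; have [dF _] := CF j; exact: dF.
split=> [p Up|v]; first by apply: differentiable_comp; [exact: dF|exact/dG/UV].
have H j : Ck k U (('D_v (fun x => F x 0 j)) * ('D_'e_j G \o F)).
  apply: CkM => //; first by have [_] := CF j; exact.
  by apply: IH => [i|]; [exact/CkS/CF|exact: DG].
have := Ck_sum (index_enum 'I_m) oU H.
apply: Ck_ext => // p Up; rewrite derive_comp_partials //.
- exact: dF.
- exact/dG/UV.
Qed.

Fixpoint C1k (k : nat) (phi : R -> R) : Prop :=
  match k with
  | 0 => continuous phi
  | k'.+1 => (forall t, derivable phi t 1) /\ C1k k' phi^`()%classic
  end.

Lemma derive_comp1 (phi : R -> R) (f : 'rV[R]_n -> R) (p v : 'rV[R]_n) :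
  differentiable f p -> derivable phi (f p) 1 ->
  'D_v (phi \o f) p = 'D_v f p * phi^`()%classic (f p).
Proof.
move=> df dphi; have dphi' : differentiable phi (f p) by exact/derivable1_diffP.
rewrite deriveE; last exact: differentiable_comp.
by rewrite diff_comp //= deriv1E // -deriveE.
Qed.

Lemma Ck_comp1 k (U : set 'rV[R]_n) (phi : R -> R) (f : 'rV[R]_n -> R) :
  open U -> C1k k phi -> Ck k U f -> Ck k U (phi \o f).
Proof.
move=> oU; elim: k phi => [|k IH] phi.
  by move=> cphi cf p Up; apply: continuous_comp; [exact: cf|exact: cphi].
move=> [dphi Dphi] Cf; have [df Df] := Cf; split=> [p Up|v].
  by apply: differentiable_comp; [exact: df|exact/derivable1_diffP].
have := CkM oU (Df v) (IH _ Dphi (CkS Cf)).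
by apply: Ck_ext => // p Up; rewrite derive_comp1 //; exact: df.
Qed.

Lemma C1k_sincos k (a b : R) : C1k k (fun t => a * cos t + b * sin t).
Proof.
have H (c d t : R) : is_derive t 1 (fun t => c * cos t + d * sin t)
    (d * cos t + (- c) * sin t).
  by apply: is_derive_eq; rewrite /GRing.scale /=; ring.
elim: k a b => [|k IH] a b /=.
  move=> t; apply: differentiable_continuous; apply/derivable1_diffP.
  by have [] := H a b t.
split=> [t|]; first by have [] := H a b t.
have -> : (fun t => a * cos t + b * sin t)^`()%classic =
   (fun t => b * cos t + (- a) * sin t).
  by apply/funext => t; rewrite derive1E; have [_ ->] := H a b t.
exact: IH.
Qed.

End ComposedCk.

Section VectorCk.
Variables (R : realType) (n m : nat).

Lemma Ck_onP k (U : set 'rV[R]_n) (F : 'rV[R]_n -> 'rV[R]_m) : open U ->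
  Ck_on k U F <-> forall j, Ck k U (fun x => F x 0 j).
Proof.
move=> oU; elim: k F => [|k IH] F /=.
  split=> [cF j p Up|cF p Up].
    by move: j; apply/continuous_rowP; exact: cF.
  by apply/continuous_rowP => j; exact: cF.
split=> [[dF DF] j|CF].
  split=> [p Up|v]; first by move: j; apply/differentiable_rowP; exact: dF.
  have /(_ j) := (IH _).1 (DF v); apply: Ck_ext => // p Up.
  by rewrite derive_row //; exact: dF.
have dF p : U p -> differentiable F p.
  by move=> Up; apply/differentiable_rowP => j; have [dF _] := CF j; exact: dF.
split=> // v; apply/IH => j; have [_ /(_ v)] := CF j.
by apply: Ck_ext => // p Up; rewrite derive_row //; exact: dF.
Qed.

End VectorCk.

Section Flat.
Variable R : realType.

Lemma C1k_lin k (a b : R) (f g : R -> R) :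
  C1k k f -> C1k k g -> C1k k (fun t => a * f t + b * g t).
Proof.
elim: k f g => [|k IH] f g /=.
  move=> cf cg t; apply: (@continuousD _ _ _ (fun t => a * f t) (fun t => b * g t)).
    by apply: (@continuousM _ _ (cst a) f); [exact: cst_continuous|exact: cf].
  by apply: (@continuousM _ _ (cst b) g); [exact: cst_continuous|exact: cg].
move=> [df Df] [dg Dg].
have H (t : R) : is_derive t 1 (fun t => a * f t + b * g t)
   (a * f^`()%classic t + b * g^`()%classic t).
  rewrite !derive1E; have := derivableP (df t); have := derivableP (dg t) => ? ?.
  by apply: is_derive_eq; rewrite /GRing.scale /=; ring.
split=> [t|]; first by have [] := H t.
have -> : (fun t => a * f t + b * g t)^`()%classic =
   (fun t => a * f^`()%classic t + b * g^`()%classic t).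
  by apply/funext => t; rewrite [LHS]derive1E; have [_ ->] := H t.
exact: IH.
Qed.

Lemma expR_ge_pow k (y : R) : 0 <= y -> y ^+ k.+1 <= k.+1%:R ^+ k.+1 * expR y.
Proof.
move=> y0; have k0 : (k.+1%:R : R) != 0 by rewrite pnatr_eq0.
have -> : expR y = expR (y / k.+1%:R) ^+ k.+1.
  by rewrite -expRM_natl mulrC divfK.
rewrite -exprMn ler_pXn2r ?nnegrE ?mulr_ge0 ?expR_ge0 //.
rewrite -ler_pdivrMl ?ltr0n // mulrC.
by apply: le_trans (expR_ge1Dx _); rewrite lerDr.
Qed.

(** For j = 0 this is the standard smooth function that vanishes to infinite order at
0. The powers of 1 / t make the family stable under differentiation, which is how
smoothness is proved. *)
Definition flat (j : nat) (t : R) : R :=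
  if 0 < t then t^-1 ^+ j * expR (- t^-1) else 0.

Lemma flat_ge0 j t : 0 <= flat j t.
Proof. by rewrite /flat; case: ifP => // t0; rewrite mulr_ge0 ?expR_ge0 ?exprn_ge0 ?invr_ge0 ?ltW. Qed.

(** With y = 1 / t this is y^(j+1) <= (j+1)^(j+1) e^y. It gives the continuity of all
[flat j] at 0, and hence their derivative there, as [flat j t / t] is
[flat j.+1 t]. *)
Lemma flat_le j t : flat j t <= j.+1%:R ^+ j.+1 * `|t|.
Proof.
rewrite /flat; case: ifP => [t0|_]; last by rewrite mulr_ge0 ?exprn_ge0.
have y0 : 0 < t^-1 by rewrite invr_gt0.
have := expR_ge_pow j (ltW y0); rewrite exprS => H.
rewrite expRN ler_pdivrMr ?expR_gt0 // gtr0_norm //.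
by rewrite mulrAC -ler_pdivrMr // mulrC.
Qed.

Lemma is_derive_flat j (t : R) :
  is_derive t (1 : R) (flat j) (flat j.+2 t - j%:R * flat j.+1 t).
Proof.
have [t0|t0|->] := ltgtP t 0.
- have -> : flat j.+2 t - j%:R * flat j.+1 t = 0.
    by rewrite /flat ltNge ltW //= mulr0 subrr.
  apply: (@near_eq_is_derive R R R (cst 0)).
  have : \near t, t < 0 by apply: lt_nbhsl.
  by apply: filterS => x x0; rewrite /flat ltNge ltW.
- apply: (@near_eq_is_derive R R R (fun x => x^-1 ^+ j * expR (- x^-1))).
    have : \near t, 0 < t by apply: lt_nbhsr.
    by apply: filterS => x x0; rewrite /flat x0.
  have tn : t != 0 by rewrite gt_eqF.
  have H1 : is_derive t 1 (fun x : R => x^-1) (- t ^- 2).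
    have := @is_deriveV R id t 1 1 tn (is_derive_id _ _).
    by move=> H; apply: is_derive_eq; rewrite /GRing.scale /= mulr1.
  have H2 : is_derive t 1 (fun x : R => expR (- x^-1)) (expR (- t^-1) * t ^- 2).
    apply: (@is_derive1_comp _ expR (fun x : R => - x^-1) t).
    by apply: is_derive_eq; rewrite opprK.
  have H3 : is_derive t 1 (fun x : R => x^-1 ^+ j) ((j%:R * t^-1 ^+ j.-1) * (- t ^- 2)).
    have := @is_deriveX R R (fun x : R => x^-1) j t 1 _ H1.
    by rewrite exprfctE.
  have := @is_deriveM R R (fun x : R => x^-1 ^+ j) (fun x : R => expR (- x^-1))
    t 1 _ _ H3 H2.
  move=> H; apply: (is_derive_eq H); rewrite /GRing.scale /= /flat t0 {H H2 H3}.
  rewrite -!exprVn; move: (t^-1) (expR _) => y E.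
  case: j => [|j]; rewrite /= !exprS ?expr0; ring.
- have -> : flat j.+2 0 - j%:R * flat j.+1 0 = 0.
    by rewrite /flat ltxx mulr0 subrr.
  have H : h^-1 *: (flat j (h *: 1 + 0) - flat j 0) @[h --> 0^'] --> (0 : R).
    apply/cvgr0Pnorm_le => e e0.
    pose C : R := j.+2%:R ^+ j.+2.
    have C0 : 0 < C by rewrite exprn_gt0.
    near=> h.
    have hn : h != 0 by near: h; exact: nbhs_dnbhs_neq.
    have -> : h^-1 *: (flat j (h *: 1 + 0) - flat j 0) = flat j.+1 h.
      rewrite addr0 /GRing.scale /= mulr1 /flat ltxx subr0.
      by case: ifP => _; rewrite ?mulr0 // mulrA -exprS.
    rewrite ger0_norm ?flat_ge0 //; apply: le_trans (flat_le _ _) _.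
    rewrite -/C -ler_pdivlMl //; near: h; apply: dnbhs0_le.
    by rewrite mulr_gt0 ?invr_gt0.
  split; first by apply/cvg_ex; exists 0.
  exact: cvg_lim H.
Unshelve. all: by end_near. Qed.

Lemma C1k_flat k j : C1k k (flat j).
Proof.
elim: k j => [|k IH] j /=.
  move=> t; apply: differentiable_continuous; apply/derivable1_diffP.
  by have [] := is_derive_flat j t.
split=> [t|]; first by have [] := is_derive_flat j t.
have -> : (flat j)^`()%classic = fun t => 1 * flat j.+2 t + (- j%:R) * flat j.+1 t.
  by apply/funext => t; rewrite derive1E mul1r mulNr; have [_ ->] := is_derive_flat j t.
exact: C1k_lin.
Qed.

End Flat.

Section VectorOperations.
Variables (R : realType) (n : nat).

Definition Ck_row m k (U : set 'rV[R]_n) (F : 'rV[R]_n -> 'rV[R]_m) :=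
  forall j, Ck k U (fun q => F q 0 j).

Lemma Ck_row_diff m k U (F : 'rV[R]_n -> 'rV[R]_m) p :
  Ck_row k.+1 U F -> U p -> differentiable F p.
Proof.
by move=> CF Up; apply/differentiable_rowP => j; have [+ _] := CF j; exact.
Qed.

Lemma is_derive_lincomb m (F : 'rV[R]_n -> 'rV[R]_m) (c : 'I_m -> R) p v :
  differentiable F p ->
  is_derive p v (fun q => \sum_i F q 0 i * c i) (\sum_i ('D_v F p) 0 i * c i).
Proof.
move=> dF; have H1 i : is_derive p v (fun q => F q 0 i * c i) (('D_v F p) 0 i * c i).
  have H0 : is_derive p v (fun q => F q 0 i) (('D_v F p) 0 i).
    split; last by rewrite derive_row.
    by apply: diff_derivable; move: i; apply/differentiable_rowP.
  have H' := @is_deriveM R _ (fun q => F q 0 i) (cst (c i)) p v _ _ H0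
    (is_derive_cst _ _ _).
  by apply: (is_derive_eq H'); rewrite scaler0 add0r /GRing.scale /= mulrC.
have := @is_derive_sum R _ _ m (fun i q => F q 0 i * c i) p v _ H1.
by congr (is_derive p _ _ _); apply/funext => q; rewrite fct_sumE.
Qed.

Lemma is_derive_coord (p v : 'rV[R]_n) i :
  is_derive p v (fun q : 'rV[R]_n => q 0 i) (v 0 i).
Proof.
split; first exact: diff_derivable (differentiable_coord _ _ _).
by rewrite -(derive_row (F := id)) ?derive_id.
Qed.

Lemma injective_diff_row_free m (F : 'rV[R]_n -> 'rV[R]_m) p :
  injective ('d F p) -> row_free ('J F p).
Proof.
move=> injF; apply: inj_row_free => v; rewrite mul_rV_lin1 => Fv.
by apply: injF; rewrite Fv linear0.
Qed.

Lemma Ck_row_mulmx m k l U (F : 'rV[R]_n -> 'rV[R]_m) (T : 'M[R]_(m, l)) :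
  open U -> Ck_row k U F -> Ck_row k U (fun q => F q *m T).
Proof.
move=> oU CF j.
have := Ck_sum (index_enum 'I_m) oU (fun i => CkZ (T i j) oU (CF i)).
apply: Ck_ext => // q Uq; rewrite mxE.
by apply: eq_bigr => i _; rewrite mulrC.
Qed.

Lemma derive_mulmx m l (F : 'rV[R]_n -> 'rV[R]_m) (T : 'M[R]_(m, l)) p v :
  differentiable F p -> 'D_v (fun q => F q *m T) p = 'D_v F p *m T.
Proof.
move=> dF; apply/rowP => j.
have HE : (fun q => (F q *m T) 0 j) = (fun q => \sum_i F q 0 i * T i j).
  by apply/funext => q; rewrite mxE.
rewrite derive_row.
  rewrite HE mxE; have [_ ->] := is_derive_lincomb (fun i => T i j) v dF.
  by [].
apply/differentiable_rowP => k.
have -> : (fun q => (F q *m T) 0 k) = \sum_i (fun q => T i k *: F q 0 i).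
  by apply/funext => q; rewrite mxE fct_sumE; apply: eq_bigr => i _; rewrite mulrC.
apply: differentiable_sum => i; apply: differentiableZ.
by move: i; apply/differentiable_rowP.
Qed.

Lemma second_derive_mulmx m l U (F : 'rV[R]_n -> 'rV[R]_m) (T : 'M[R]_(m, l))
    p v : open U -> U p -> Ck_row 2 U F ->
  'D_v ('D_v (fun q => F q *m T)) p = 'D_v ('D_v F) p *m T.
Proof.
move=> oU Up CF.
have E : \near p, 'D_v F p *m T = 'D_v (fun q => F q *m T) p.
  apply: filterS (open_nbhs_nbhs (conj oU Up)) => q Uq.
  by rewrite derive_mulmx //; exact: Ck_row_diff CF Uq.
rewrite -(near_eq_derive _ E) derive_mulmx //.
by have /(Ck_onP 2 F oU) [_ /(_ v) [+ _]] := CF; exact.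
Qed.

Lemma Ck_row_row_mx k m1 m2 U (F : 'rV[R]_n -> 'rV[R]_m1) (G : 'rV[R]_n -> 'rV[R]_m2) :
  Ck_row k U F -> Ck_row k U G -> Ck_row k U (fun q => row_mx (F q) (G q)).
Proof.
move=> CF CG j; case: (split_ordP j) => i ->.
  by have -> : (fun q => row_mx (F q) (G q) 0 (lshift m2 i)) = (fun q => F q 0 i)
    by apply/funext => q; rewrite row_mxEl.
by have -> : (fun q => row_mx (F q) (G q) 0 (rshift m1 i)) = (fun q => G q 0 i)
  by apply/funext => q; rewrite row_mxEr.
Qed.

Lemma derive_row_mx m1 m2 (F : 'rV[R]_n -> 'rV[R]_m1) (G : 'rV[R]_n -> 'rV[R]_m2)
    p v : differentiable F p -> differentiable G p ->
  'D_v (fun q => row_mx (F q) (G q)) p = row_mx ('D_v F p) ('D_v G p).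
Proof.
move=> dF dG.
have El i : (fun q => row_mx (F q) (G q) 0 (lshift m2 i)) = (fun q => F q 0 i).
  by apply/funext => q; rewrite row_mxEl.
have Er i : (fun q => row_mx (F q) (G q) 0 (rshift m1 i)) = (fun q => G q 0 i).
  by apply/funext => q; rewrite row_mxEr.
have dFG : differentiable (fun q => row_mx (F q) (G q)) p.
  apply/differentiable_rowP => j; case: (split_ordP j) => i ->.
    by rewrite El; move: i; apply/differentiable_rowP.
  by rewrite Er; move: i; apply/differentiable_rowP.
apply/rowP => j; rewrite derive_row //; case: (split_ordP j) => i ->.
  by rewrite El row_mxEl derive_row.
by rewrite Er row_mxEr derive_row.
Qed.

Lemma second_derive_row_mx m1 m2 U (F : 'rV[R]_n -> 'rV[R]_m1)
    (G : 'rV[R]_n -> 'rV[R]_m2) p v : open U -> U p ->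
  Ck_row 2 U F -> Ck_row 2 U G ->
  'D_v ('D_v (fun q => row_mx (F q) (G q))) p =
  row_mx ('D_v ('D_v F) p) ('D_v ('D_v G) p).
Proof.
move=> oU Up CF CG.
have E : \near p, row_mx ('D_v F p) ('D_v G p) = 'D_v (fun q => row_mx (F q) (G q)) p.
  apply: filterS (open_nbhs_nbhs (conj oU Up)) => q Uq.
  by rewrite derive_row_mx //; [exact: Ck_row_diff CF Uq|exact: Ck_row_diff CG Uq].
rewrite -(near_eq_derive _ E) derive_row_mx //.
  by have /(Ck_onP 2 F oU) [_ /(_ v) [+ _]] := CF; exact.
by have /(Ck_onP 2 G oU) [_ /(_ v) [+ _]] := CG; exact.
Qed.

Lemma derive_sincos (a b : R) (y : 'rV[R]_n -> R) p v : differentiable y p ->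
  'D_v (fun q => a * cos (y q) + b * sin (y q)) p =
  (b * cos (y p) - a * sin (y p)) * 'D_v y p.
Proof.
move=> dy; pose phi t := a * cos t + b * sin t.
have H (t : R) : is_derive t 1 phi (b * cos t - a * sin t).
  by apply: is_derive_eq; rewrite /GRing.scale /=; ring.
have [dphi phiE] := H (y p).
have -> : (fun q => a * cos (y q) + b * sin (y q)) = phi \o y by [].
by rewrite derive_comp1 // derive1E phiE mulrC.
Qed.

(** The curve (cos y, sin y) has acceleration y'^2 towards the centre and y'' along
the circle. *)
Lemma second_derive_sincos (a b : R) U (y : 'rV[R]_n -> R) p v :
  open U -> U p -> Ck 2 U y ->
  'D_v ('D_v (fun q => a * cos (y q) + b * sin (y q))) p =
  - (a * cos (y p) + b * sin (y p)) * 'D_v y p ^+ 2 +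
  (b * cos (y p) - a * sin (y p)) * 'D_v ('D_v y) p.
Proof.
move=> oU Up Cy; have [dy Dy] := Cy.
pose z (q : 'rV[R]_n) := b * cos (y q) + (- a) * sin (y q).
have E : \near p, (z * 'D_v y) p = 'D_v (fun q => a * cos (y q) + b * sin (y q)) p.
  apply: filterS (open_nbhs_nbhs (conj oU Up)) => q Uq.
  by rewrite derive_sincos; [rewrite /z -mulNr|exact: dy].
rewrite -(near_eq_derive _ E).
have Cz : Ck 1 U z.
  exact: (Ck_comp1 oU (C1k_sincos 1 b (- a)) (CkS Cy)).
have dz : derivable z p v.
  by apply: diff_derivable; have [+ _] := Cz; exact.
have dDy : derivable ('D_v y) p v.
  by apply: diff_derivable; have [+ _] := Dy v; exact.
rewrite (deriveM dz dDy) /z derive_sincos; last exact: dy.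
by rewrite /GRing.scale /=; ring.
Qed.

End VectorOperations.

Lemma second_derive_row (R : realType) (n m : nat) (U : set 'rV[R]_n)
    (F : 'rV[R]_n -> 'rV[R]_m) (p u v : 'rV[R]_n) i : open U -> U p ->
  (forall j, Ck 2 U (fun q => F q 0 j)) ->
  ('D_u ('D_v F) p) 0 i = 'D_u ('D_v (fun q => F q 0 i)) p.
Proof.
move=> oU Up CF.
have /(Ck_onP 2 F oU) [dF DF] := CF.
have [dDF _] := DF v; rewrite derive_row; last exact: dDF.
apply: near_eq_derive; apply: filterS (open_nbhs_nbhs (conj oU Up)) => q Uq.
by rewrite derive_row //; exact: dF.
Qed.

(** * Charts, compactness and a smooth injection into some R^K *)

Section Compactness.
Variables (R : realType) (T : topologicalType).

Lemma compact_subcover (A : set T) (W : T -> set T) : compact A ->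
  (forall x, A x -> nbhs x (W x)) ->
  exists s : seq T, (forall x, x \in s -> A x) /\
    forall y, A y -> exists2 x, x \in s & W x y.
Proof.
move=> cA nW.
(* The filter of the properties that hold for all lists extending some finite list of
   points of A; near-covering for it is the existence of a finite subcover. *)
pose F : set_system (seq T) := [set P : set (seq T) | exists s0 : seq T,
  (forall x, x \in s0 -> A x) /\ forall s : seq T, {subset s0 <= s} -> P s].
have FF : Filter F.
  split.
  - by exists [::]; split.
  - move=> P Q [s [sA sP]] [t [tA tQ]]; exists (s ++ t); split.
      by move=> x; rewrite mem_cat => /orP[/sA|/tA].
    move=> u su; split; [apply: sP|apply: tQ] => x xs; apply: su;
      by rewrite mem_cat xs ?orbT.
  - by move=> P Q PQ [s [sA sP]]; exists s; split=> // t /sP /PQ.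
have := (compact_near_coveringP A).1 cA _ F
  (fun s y => exists2 x, x \in s & W x y) FF.
case=> [x Ax|s0 [s0A s0P]]; last by exists s0; split=> //; exact: (s0P s0).
exists (W x, [set s : seq T | x \in s]); first split => /=; first exact: nW.
  exists [:: x]; split=> [y|s]; first by rewrite inE => /eqP ->.
  by apply; rewrite mem_head.
by move=> [y s] [/= Wy xs]; exists x.
Qed.

(** A property with a parameter C that becomes weaker as C grows holds uniformly on a
compact set as soon as it holds locally. *)
Lemma compact_uniform (A : set T) (P : R -> T -> Prop) : compact A ->
  (forall C C' y, C <= C' -> P C y -> P C' y) ->
  (forall x, A x -> exists C, \near x, P C x) ->
  exists C, forall y, A y -> P C y.
Proof.
move=> cA mono loc.
have /choice [C CP] x : exists C, A x -> nbhs x [set y | P C y].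
  by have [/loc [C CP]|nA] := pselect (A x); [exists C|exists 0].
have [s [sA sP]] := compact_subcover cA CP.
exists (\sum_(x <- s) `|C x|) => y Ay; have [x xs] := sP y Ay.
apply: mono; rewrite (perm_big _ (perm_to_rem xs)) big_cons.
apply: le_trans (ler_norm _) _; rewrite lerDl.
by apply: sumr_ge0.
Qed.

End Compactness.

Section ChartBasics.
Variables (R : realType) (n : nat) (X : topologicalType) (c : chart R n X).
Local Notation dom := (chart_dom c).
Local Notation cod := (chart_cod c).

Lemma chart_codP p : cod p -> dom (chart_inv c p) /\ chart_map c (chart_inv c p) = p.
Proof. by case=> x dx <-; rewrite chart_mapK. Qed.

Lemma chart_map_cod x : dom x -> cod (chart_map c x).
Proof. by move=> dx; exists x. Qed.

Lemma chart_map_cts x : dom x -> {for x, continuous (chart_map c)}.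
Proof.
move=> dx; have := @chart_map_continuous _ _ _ c.
rewrite continuous_open_subspace; last exact: chart_dom_open.
by apply; rewrite inE.
Qed.

Lemma chart_inv_cts p : cod p -> {for p, continuous (chart_inv c)}.
Proof.
move=> cp; have := @chart_inv_continuous _ _ _ c.
rewrite continuous_open_subspace; last exact: chart_cod_open.
by apply; rewrite inE.
Qed.

Lemma chart_image_open (U : set X) : open U -> open (chart_map c @` (dom `&` U)).
Proof.
move=> oU; rewrite openE => p [x [dx Ux] xp].
have cp : cod p by exists x.
have [dp mp] := chart_codP cp.
have ip : chart_inv c p = x by rewrite -xp chart_mapK.
have H : nbhs p (chart_inv c @^-1` U).
  by apply: chart_inv_cts => //; rewrite ip; exact: open_nbhs_nbhs.
have := open_nbhs_nbhs (conj (@chart_cod_open _ _ _ c) cp).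
apply: filterS2 H => q /= Uq /chart_codP [dq mq].
by exists (chart_inv c q).
Qed.

(** Turns statements near a point of R^n into statements near a point of X. *)
Lemma chart_near x (P : 'rV[R]_n -> Prop) : dom x ->
  nbhs (chart_map c x) P -> \near x, dom x /\ P (chart_map c x).
Proof.
move=> dx HP; have := chart_map_cts dx HP.
have := open_nbhs_nbhs (conj (@chart_dom_open _ _ _ c) dx).
by apply: filterS2.
Qed.

End ChartBasics.

Section SmoothScalars.
Variables (R : realType) (n : nat) (X : smoothManifold R n).
Implicit Types (h : X -> R) (c d : chart R n X).

Lemma chart_codO c : open (chart_cod c). Proof. exact: chart_cod_open. Qed.
Arguments chart_codO : clear implicits.

Definition smooth_scalar h : Prop :=
  forall c, atlas c -> forall k, Ck k (chart_cod c) (h \o chart_inv c).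

Lemma smooth_mapP m (f : X -> 'rV[R]_m) :
  smooth_map f <-> forall j, smooth_scalar (fun x => f x 0 j).
Proof.
split=> [sf j c ac k|sf c ac k]; first by have /(Ck_onP _ _ (chart_codO c)) := sf c ac k; exact.
by apply/(Ck_onP _ _ (chart_codO c)) => j; exact: sf.
Qed.

Lemma smooth_scalar_continuous h : smooth_scalar h -> continuous h.
Proof.
move=> sh x; have [c ac dx] := atlas_cover x.
have /= H := sh c ac 0%N (chart_map c x) (chart_map_cod dx).
have E : {near x, (h \o chart_inv c) \o chart_map c =1 h}.
  have := open_nbhs_nbhs (conj (@chart_dom_open _ _ _ c) dx).
  by apply: filterS => y dy /=; rewrite chart_mapK.
have C : {for x, continuous ((h \o chart_inv c) \o chart_map c)}.
  by apply: continuous_comp => //; exact: chart_map_cts.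
rewrite /prop_for /continuous_at -(nbhs_singleton E).
by apply: cvg_trans C; apply: near_eq_cvg; apply: filterS E => y ->.
Qed.

(** Near a point outside the domain of d the extension vanishes: since X is
Hausdorff, the compact set that d maps onto B is closed in X. *)
Lemma smooth_scalar_extend d (psi : 'rV[R]_n -> R) (B : set 'rV[R]_n) :
  atlas d -> compact B -> B `<=` chart_cod d -> (forall k, Ck k setT psi) ->
  (forall p, ~ B p -> psi p = 0) ->
  smooth_scalar (fun x => if `[< chart_dom d x >] then psi (chart_map d x) else 0).
Proof.
move=> ad cB Bd spsi psi0 c ac k.
pose Kd := chart_inv d @` B.
have clK : closed Kd.
  apply: compact_closed; first exact: manifold_hausdorff.
  apply: continuous_compact => //.
  apply: (@continuous_subspaceW _ _ _ (chart_cod d)) => //.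
  exact: chart_inv_continuous.
apply: Ck_local => p cp; have [dp mp] := chart_codP cp.
have [ddp|nd] := pselect (chart_dom d (chart_inv c p)).
  have oV := @chart_image_open _ _ _ c _ (@chart_dom_open _ _ _ d).
  exists (chart_map c @` (chart_dom c `&` chart_dom d)).
    by exists (chart_inv c p).
  have /(Ck_onP _ _ oV) sT := atlas_compatible ac ad k.
  have := Ck_comp oV openT (fun _ _ => I) sT (spsi k).
  apply: Ck_ext => // q [x [dx ddx] <-] /=.
  by rewrite chart_mapK //; case: asboolP.
have oK : open (~` Kd) by exact: closed_openC.
exists (chart_map c @` (chart_dom c `&` ~` Kd)).
  exists (chart_inv c p) => //; split=> // -[q Bq qp]; apply: nd.
  by rewrite -qp; have [] := chart_codP (Bd _ Bq).
apply: Ck_ext (Ck_cst k _ 0); first exact: chart_image_open.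
move=> q [x [dx Kx] <-] /=; rewrite chart_mapK //; case: asboolP => // ddx.
rewrite psi0 // => Bx; apply: Kx; exists (chart_map d x) => //.
exact: chart_mapK.
Qed.

End SmoothScalars.
Arguments chart_codO {R n X} c.

Section RowSpace.
Variables (R : realType) (n : nat).

Lemma row_norm_coord (u : 'rV[R]_n) j : `|u 0 j| <= `|u|.
Proof.
rewrite [leRHS]/Num.Def.normr /= mx_normrE.
by apply/bigmax_geP; right; exists (0, j).
Qed.

Lemma row_norm_le (u : 'rV[R]_n) (r : R) : 0 <= r ->
  (forall j, `|u 0 j| <= r) -> `|u| <= r.
Proof.
move=> r0 ur; rewrite [leLHS]/Num.Def.normr /= mx_normrE; apply: bigmax_le => //.
by move=> [i j] _ /=; rewrite ord1.
Qed.

Lemma closed_ball_compact_row (p : 'rV[R]_n) (r : R) : 0 < r ->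
  compact (closed_ball p r).
Proof.
move=> r0; apply: bounded_closed_compact; last exact: closed_ball_closed.
rewrite closed_ballE //; exists (`|p| + r); split; first exact: num_real.
move=> x lt q /= qp; apply: le_trans (ltW lt).
rewrite -[q](subrK p) addrC (le_trans (ler_normD _ _)) // lerD2l distrC //.
Qed.

(** The mean value theorem along a segment, which stays in the ball by convexity. *)
Lemma partials_lipschitz (p : 'rV[R]_n) (r : R) (h : 'rV[R]_n -> R) (b : R) :
  (forall q, ball p r q -> differentiable h q) ->
  (forall q, ball p r q -> forall k, `|'D_'e_k h q| <= b) ->
  forall q q', ball p r q -> ball p r q' ->
    `|h q - h q'| <= b * \sum_k `|q 0 k - q' 0 k|.
Proof.
move=> dh hb q q' Bq Bq'; pose w := q - q'.
pose line (t : R) : 'rV[R]_n := t *: w + q'.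
have Bl t : 0 <= t <= 1 -> ball p r (line t).
  move=> /andP[t0 t1]; move: Bq Bq'; rewrite -ball_normE /ball_ /= => Bq Bq'.
  have -> : p - line t = t *: (p - q) + (1 - t) *: (p - q').
    apply/rowP => j; rewrite !mxE; ring.
  apply: le_lt_trans (ler_normD _ _) _; rewrite !normrZ !ger0_norm ?subr_ge0 //.
  have [->|tn] := eqVneq t 0; first by rewrite mul0r add0r subr0 mul1r.
  have tp : 0 < t by rewrite lt_def tn.
  have : t * `|p - q| < t * r by rewrite ltr_pM2l.
  have : (1 - t) * `|p - q'| <= (1 - t) * r by rewrite ler_wpM2l ?subr_ge0 // ltW.
  lra.
have Dl (t : R) : is_diff t line ( *:%R ^~ w + 0).
  exact: (is_diffD (is_diff_scalel t w) (is_diff_cst q' t)).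
have dline (t : R) : differentiable line t by have [] := Dl t.
have dl (t : R) : 'D_1 line t = w.
  by rewrite deriveE // diff_val fctE addr0 scale1r.
have dphi (t : R) : 0 <= t <= 1 -> is_derive t 1 (h \o line) ('D_w h (line t)).
  move=> /Bl Bt; have dht := dh _ Bt.
  have D : differentiable (h \o line) t by exact: differentiable_comp.
  apply: DeriveDef; first exact: diff_derivable.
  rewrite deriveE // diff_comp //= -deriveE // -deriveE //.
  by rewrite dl.
have [||xi xi01] := @MVT R (h \o line) (fun t => 'D_w h (line t)) 0 1 ltr01.
- by move=> t; rewrite in_itv /= => /andP[t0 t1]; apply: dphi; rewrite !ltW.
- apply: derivable_within_continuous => t; rewrite in_itv /= => /dphi.
  by case.
rewrite subr0 mulr1 /= /line scale1r scale0r add0r /w subrK => ->.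
have {xi01} xi01 : 0 <= xi <= 1.
  by move: xi01; rewrite in_itv /= => /andP[? ?]; rewrite !ltW.
have Bx := Bl _ xi01.
rewrite derive_partials; last exact: dh.
apply: le_trans (ler_norm_sum _ _ _) _; rewrite mulr_sumr.
apply: ler_sum => k _; rewrite normrM mulrC !mxE ler_wpM2r //.
exact: hb.
Qed.

End RowSpace.

Section InjectiveCoordinates.
Variables (R : realType) (n : nat) (X : smoothManifold R n).

(** A bump function phi at x, supported in a chart, together with the products of phi
with the coordinates of this chart: where phi does not vanish, the quotients
recover the coordinates. *)
Lemma chart_bump (x : X) : exists (phi : X -> R) (eta : 'I_n -> X -> R),
  [/\ smooth_scalar phi, forall j, smooth_scalar (eta j), phi x != 0 &
    forall y y', phi y != 0 -> phi y = phi y' ->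
      (forall j, eta j y = eta j y') -> y = y'].
Proof.
have [d ad dx] := atlas_cover x; pose p := chart_map d x.
have /nbhs_closedballP [rp rB] :=
  open_nbhs_nbhs (conj (chart_codO d) (chart_map_cod dx)).
have [r r0 {}rB] : exists2 r, 0 < r & closed_ball p r `<=` chart_cod d.
  by exists rp%:num.
pose B := closed_ball p r.
(* Supported in the Euclidean ball of radius r, which the ball B of the sup norm
   contains. *)
pose psi (q : 'rV[R]_n) : R :=
  flat 0 (r ^+ 2 + \sum_j (- 1) * ((q 0 j - p 0 j) * (q 0 j - p 0 j))).
have spsi k : Ck k setT psi.
  have C j : Ck k setT (fun q : 'rV[R]_n => q 0 j - p 0 j).
    exact: (CkD openT (Ck_coord k setT j) (Ck_cst k setT (- p 0 j))).
  have S := Ck_sum (index_enum 'I_n) openT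
    (fun j => CkZ (- 1) openT (CkM openT (C j) (C j))).
  exact: (Ck_comp1 openT (C1k_flat R k 0) (CkD openT (Ck_cst k setT (r ^+ 2)) S)).
have psi0 q : ~ B q -> psi q = 0.
  move=> nB; rewrite /psi /flat; case: ifP => // lt; case: nB.
  rewrite /B closed_ballE //; apply: row_norm_le; first exact: ltW.
  move=> j; rewrite !mxE -ler_sqr ?nnegrE ?(ltW r0) // real_normK ?num_real //.
  rewrite (bigD1 j) //= in lt.
  have le0 : \sum_(i < n | i != j) -1 * ((q 0 i - p 0 i) * (q 0 i - p 0 i)) <= 0.
    by apply: sumr_le0 => i _; rewrite mulN1r oppr_le0 -expr2 sqr_ge0.
  by have -> : (p 0 j - q 0 j) ^+ 2 = (q 0 j - p 0 j) * (q 0 j - p 0 j);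
    [ring | lra].
have cB : compact B by exact: closed_ball_compact_row.
pose ext (g : 'rV[R]_n -> R) y := if `[< chart_dom d y >] then g (chart_map d y) else 0.
exists (ext psi), (fun j => ext (fun q => psi q * q 0 j)); split.
- exact: (smooth_scalar_extend ad cB).
- move=> j; apply: (smooth_scalar_extend ad cB) => // [k|q nB].
    exact: (CkM openT (spsi k) (Ck_coord k setT j)).
  by rewrite psi0 // mul0r.
- rewrite /ext; case: asboolP => // _; rewrite -/p /psi big1 ?addr0; last first.
    by move=> j _; rewrite subrr !mulr0.
  by rewrite /flat exprn_gt0 // expr0 mul1r gt_eqF // expR_gt0.
- move=> y y'; rewrite /ext; case: asboolP => [dy|_]; last by rewrite eqxx.
  case: asboolP => [dy'|_] nz; last by move=> e; rewrite e eqxx in nz.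
  move=> e ee; rewrite -(chart_mapK dy) -(chart_mapK dy'); congr chart_inv.
  by apply/rowP => j; apply: (mulfI nz); rewrite ee e.
Qed.

Lemma injective_coordinates : closed_manifold X ->
  exists (I : finType) (H : X -> I -> R),
    (forall i, smooth_scalar (fun x => H x i)) /\
    (forall x y, (forall i, H x i = H y i) -> x = y).
Proof.
move=> cX; have /choice [phi phiP] := chart_bump.
have /choice [eta etaP] := phiP.
have [|s [_ sP]] := compact_subcover (W := fun x => [set y | phi x y != 0]) cX.
  move=> x _; have [sphi _ nz _] := etaP x.
  have C := @smooth_scalar_continuous _ _ _ _ sphi x.
  apply: (C [set t | t != 0]).
  exact: (open_nbhs_nbhs (conj (@open_neq _ 0) nz)).
exists (seq_sub s * option 'I_n)%type.
exists (fun y i => if i.2 is Some j then eta (ssval i.1) j y else phi (ssval i.1) y).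
split=> [[x [j|]]|y y' e] /=.
- by have [_ /(_ j)] := etaP (ssval x).
- by have [] := etaP (ssval x).
have [x xs nz] := sP y I; have [_ _ _ inj] := etaP x.
apply: inj => //; first exact: (e (SeqSub xs, None)).
by move=> j; exact: (e (SeqSub xs, Some j)).
Qed.

End InjectiveCoordinates.

(** * Derivative estimates near a point and changes of charts *)

Lemma near_forall (T : topologicalType) (I : finType) (p : T) (P : I -> T -> Prop) :
  (forall i, \near p, P i p) -> \near p, forall i, P i p.
Proof. exact: (@filter_forall T I P (nbhs p)). Qed.

Section LocalEstimates.
Variables (R : realType) (n : nat).
Implicit Types (U : set 'rV[R]_n) (p q u v : 'rV[R]_n).

Lemma derive_comp n' m (W : normedModType R) (F : 'rV[R]_n' -> 'rV[R]_m) (G : 'rV[R]_m -> W)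
    (p v : 'rV[R]_n') : differentiable F p -> differentiable G (F p) ->
  'D_v (G \o F) p = 'D_('D_v F p) G (F p).
Proof.
move=> dF dG; rewrite deriveE; last exact: differentiable_comp.
by rewrite diff_comp //= -deriveE // -deriveE.
Qed.

Lemma Ck1_partial_continuous U (h : 'rV[R]_n -> R) p v :
  Ck 1 U h -> U p -> {for p, continuous ('D_v h)}.
Proof. by move=> [_ /(_ v)] /=; exact. Qed.

Lemma near_norm_lt (h : 'rV[R]_n -> R) p (b : R) :
  {for p, continuous h} -> `|h p| < b -> \near p, `|h p| < b.
Proof.
move=> ch hb; have H : {for p, continuous (fun q => `|h q|)}.
  exact: (continuous_comp ch (@norm_continuous _ _ _)).
exact: (H [set t | t < b] (open_nbhs_nbhs (conj (@open_lt _ b) hb))).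
Qed.

Lemma near_partials_le (I : finType) U (h : I -> 'rV[R]_n -> R) p :
  open U -> U p -> (forall i, Ck 1 U (h i)) ->
  exists b, \near p, U p /\ forall i k, `|'D_'e_k (h i) p| <= b.
Proof.
move=> oU Up Ch.
pose b := 1 + \sum_(i : I) \sum_(k < n) `|'D_'e_k (h i) p|.
exists b; have Unear := open_nbhs_nbhs (conj oU Up).
have : \near p, forall i (k : 'I_n), `|'D_'e_k (h i) p| < b.
  apply: near_forall => i; apply: near_forall => k.

  apply: near_norm_lt.
    exact: Ck1_partial_continuous (Ch i) Up.
  rewrite /b (bigD1 i) //= (bigD1 k) //=.
  set x := `|_|; set y := \sum_(_ < _ | _) _; set z := \sum_(_ | _) _.
  have y0 : 0 <= y by exact: sumr_ge0.
  have z0 : 0 <= z by apply: sumr_ge0 => j _; exact: sumr_ge0.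
  lra.
move=> N; apply: filterS2 Unear N => q Uq H; split=> // i k.
exact: ltW (H i k).
Qed.

Lemma second_derive_partials U (h : 'rV[R]_n -> R) p u : open U -> U p ->
  Ck 2 U h ->
  'D_u ('D_u h) p = \sum_k u 0 k * \sum_l u 0 l * 'D_'e_l ('D_'e_k h) p.
Proof.
move=> oU Up [dh Dh].
have E : \near p, (\sum_(k < n) (fun q => u 0 k *: 'D_'e_k h q)) p = 'D_u h p.
  apply: filterS (open_nbhs_nbhs (conj oU Up)) => q Uq.
  by rewrite fct_sumE derive_partials //; exact: dh.
have dDh k : differentiable ('D_'e_k h) p by have [+ _] := Dh 'e_k; exact.
rewrite -(near_eq_derive _ E) derive_sum; last first.
  by move=> k; apply: derivableZ; exact: diff_derivable.
apply: eq_bigr => k _; rewrite deriveZ; last exact: diff_derivable.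
by rewrite derive_partials.
Qed.

(** The second derivative along u is a quadratic form in u whose coefficients are the
second partial derivatives. *)
Lemma second_derive_le U (h : 'rV[R]_n -> R) p u (b : R) : open U -> U p ->
  Ck 2 U h -> (forall k l, `|'D_'e_l ('D_'e_k h) p| <= b) ->
  `|'D_u ('D_u h) p| <= b * (\sum_k `|u 0 k|) ^+ 2.
Proof.
move=> oU Up Ch hb; rewrite (second_derive_partials u oU Up Ch).
apply: le_trans (ler_norm_sum _ _ _) _.
rewrite expr2 mulrA mulr_sumr; apply: ler_sum => k _.
rewrite normrM mulrC ler_wpM2r //.
apply: le_trans (ler_norm_sum _ _ _) _.
rewrite mulr_sumr; apply: ler_sum => l _.
by rewrite normrM mulrC ler_wpM2r.
Qed.

(** Q is a left inverse of the differential at p. Composing G with it gives a map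
that is close to the identity in the C^1 sense near p, from which both local
injectivity and lower bounds on the differential follow. *)
Lemma immersion_left_inverse U M (G : 'rV[R]_n -> 'rV[R]_M) p (e : R) :
  open U -> U p -> (forall j, Ck 1 U (fun q => G q 0 j)) ->
  injective ('d G p) -> 0 < e ->
  exists Q : 'M[R]_(M, n),
    (forall i, Ck 1 U (fun q => \sum_j G q 0 j * Q j i - q 0 i)) /\
    \near p, U p /\ forall k i,
      `|'D_'e_k (fun q => \sum_j G q 0 j * Q j i - q 0 i) p| <= e.
Proof.
move=> oU Up CG injG e0.
have dG : differentiable G p.
  by apply/differentiable_rowP => j; have [+ _] := CG j; exact.
have rfJ := injective_diff_row_free injG.
pose Q := pinvmx ('J G p); exists Q.
have Cw i : Ck 1 U (fun q => \sum_j G q 0 j * Q j i - q 0 i).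
  have H1 : Ck 1 U (fun q => \sum_j Q j i * G q 0 j).
    exact: (Ck_sum (index_enum 'I_M) oU (fun j => CkZ (Q j i) oU (CG j))).
  have H2 := CkD oU H1 (CkZ (- 1) oU (Ck_coord 1 U i)).
  apply: Ck_ext H2 => // q Uq; rewrite !fctE mulN1r.
  by congr (_ - _); apply: eq_bigr => j _; rewrite mulrC.
split=> //.
have D0 k i : 'D_'e_k (fun q => \sum_j G q 0 j * Q j i - q 0 i) p = 0.
  have [_ ->] := is_deriveB (is_derive_lincomb (fun j => Q j i) 'e_k dG)
    (is_derive_coord p 'e_k i).
  rewrite (deriveEjacobian 'e_k dG).
  by have /rowP/(_ i) := mulmx1 ('e_k : 'rV[R]_n);
    rewrite -(mulmxVp rfJ) mulmxA mxE => ->; rewrite subrr.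
have Unear := open_nbhs_nbhs (conj oU Up).
have : \near p, forall k i : 'I_n,
    `|'D_'e_k (fun q => \sum_j G q 0 j * Q j i - q 0 i) p| < e.
  apply: near_forall => k; apply: near_forall => i; apply: near_norm_lt.
    exact: Ck1_partial_continuous (Cw i) Up.
  by rewrite D0 normr0.
move=> N; apply: filterS2 Unear N => q Uq H; split=> // k i.
exact: ltW (H k i).
Qed.

End LocalEstimates.

Section ChartChange.
Variables (R : realType) (n M : nat) (X : smoothManifold R n).
Variable g : X -> 'rV[R]_M.
Hypothesis sg : smooth_map g.

Lemma smooth_map_coord (c : chart R n X) j k : atlas c ->
  Ck k (chart_cod c) (fun q => (g \o chart_inv c) q 0 j).
Proof. by move=> ac; have /smooth_mapP := sg; apply. Qed.

Lemma smooth_map_diff (c : chart R n X) p : atlas c -> chart_cod c p ->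
  differentiable (g \o chart_inv c) p.
Proof.
move=> ac cp; apply/differentiable_rowP => j.
by have [+ _] := smooth_map_coord j 1 ac; exact.
Qed.

Section TwoCharts.
Variables (c d : chart R n X) (ac : atlas c) (ad : atlas d).
Let V := chart_map c @` (chart_dom c `&` chart_dom d).
Let tau : 'rV[R]_n -> 'rV[R]_n := chart_map d \o chart_inv c.

Let oV : open V. Proof. exact: chart_image_open (@chart_dom_open _ _ _ d). Qed.

Let Ctau k j : Ck k V (fun q => tau q 0 j).
Proof. by have /(Ck_onP _ _ oV) := atlas_compatible ac ad k; exact. Qed.

Let dtau p : V p -> differentiable tau p.
Proof.
by move=> Vp; apply/differentiable_rowP => j; have [+ _] := Ctau 1 j; exact.
Qed.

Let tau_cod p : V p -> chart_cod d (tau p).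
Proof. by case=> x [dx ddx] <-; rewrite /tau /= chart_mapK //; exists x. Qed.

Lemma transition_near p : V p ->
  \near p, (g \o chart_inv d) (tau p) = (g \o chart_inv c) p.
Proof.
move=> Vp; apply: filterS (open_nbhs_nbhs (conj oV Vp)) => q [x [dx ddx] <-].
by rewrite /tau /= chart_mapK // chart_mapK.
Qed.

Lemma derive_chart_change p v : V p ->
  'D_v (g \o chart_inv c) p = 'D_('D_v tau p) (g \o chart_inv d) (tau p).
Proof.
move=> Vp; rewrite -(near_eq_derive _ (transition_near Vp)).
exact: (derive_comp v (dtau Vp) (smooth_map_diff ad (tau_cod Vp))).
Qed.

(** Differentiating twice the composition with the transition map tau yields the
second derivative of h along the velocity of tau, plus the first derivative of h
along the acceleration of tau. *)
Lemma second_derive_chart_change_coord (h : 'rV[R]_n -> R) p v : V p ->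
  Ck 2 (chart_cod d) h ->
  'D_v ('D_v (h \o tau)) p =
  'D_('D_v tau p) ('D_('D_v tau p) h) (tau p) +
  'D_(\row_j 'D_v ('D_v (fun q => tau q 0 j)) p) h (tau p).
Proof.
move=> Vp Ch; have [dh Dh] := Ch.
pose u := 'D_v tau p; set w := \row_j _; rewrite -/u.
have tp := tau_cod Vp.
pose A j (q : 'rV[R]_n) : R := 'D_v (fun q => tau q 0 j) q.
pose B (j : 'I_n) (q : 'rV[R]_n) : R := 'D_'e_j h (tau q).
have E : \near p, (\sum_(j < n) (A j * B j)) p = 'D_v (h \o tau) p.
  apply: filterS (open_nbhs_nbhs (conj oV Vp)) => q Vq.
  rewrite fct_sumE derive_comp_partials //; first exact: dtau.
  exact/dh/tau_cod.
rewrite -(near_eq_derive _ E).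
have dA j : derivable (A j) p v.
  by apply: diff_derivable; have [_ /(_ v) [+ _]] := Ctau 2 j; exact.
have dDh j : differentiable ('D_'e_j h) (tau p).
  by have [+ _] := Dh 'e_j; exact.
have dB j : derivable (B j) p v.
  apply: diff_derivable; apply: (@differentiable_comp _ _ _ _ tau ('D_'e_j h)).
    exact: dtau.
  exact: dDh.
rewrite derive_sum; last by move=> j; exact: derivableM.
rewrite (second_derive_partials u (chart_codO d) tp Ch).
rewrite (derive_partials w (dh _ tp)) -big_split /=.
apply: eq_bigr => j _; rewrite (deriveM (dA j) (dB j)); congr (_ + _).
  rewrite /GRing.scale /=; congr (_ * _).
    by rewrite /A -derive_row //; exact: dtau.
  transitivity ('D_u ('D_'e_j h) (tau p)).
    exact: (derive_comp _ (dtau Vp) (dDh j)).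
  by rewrite derive_partials.
by rewrite mxE /GRing.scale /= mulrC.
Qed.

Lemma second_derive_chart_change p v : V p ->
  'D_v ('D_v (g \o chart_inv c)) p =
  'D_('D_v tau p) ('D_('D_v tau p) (g \o chart_inv d)) (tau p) +
  'D_(\row_j 'D_v ('D_v (fun q => tau q 0 j)) p) (g \o chart_inv d) (tau p).
Proof.
move=> Vp; have tp := tau_cod Vp.
have cp : chart_cod c p by case: Vp => x [dx _] <-; exists x.
apply/rowP => i; rewrite mxE.
pose gi : 'rV[R]_n -> R := fun q => (g \o chart_inv d) q 0 i.
have Ec := second_derive_row v v i (chart_codO c) cp
  (fun j => smooth_map_coord j 2 ac).
have Ed := second_derive_row ('D_v tau p) ('D_v tau p) i (chart_codO d) tp
  (fun j => smooth_map_coord j 2 ad).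
have E1 := derive_row (\row_j 'D_v ('D_v (fun q => tau q 0 j)) p) i
  (smooth_map_diff ad tp).
have E2 : 'D_v ('D_v (fun q => (g \o chart_inv c) q 0 i)) p =
    'D_v ('D_v (gi \o tau)) p.
  apply: near_eq_derive; apply: filterS (open_nbhs_nbhs (conj oV Vp)) => q Vq.
  apply: near_eq_derive; apply: filterS (transition_near Vq) => r /= e.
  by rewrite /gi /= -e.
have E3 := second_derive_chart_change_coord v Vp (smooth_map_coord i 2 ad).
apply: (etrans Ec); apply: (etrans E2); apply: (etrans E3).
by congr (_ + _); [exact: esym Ed|exact: esym E1].
Qed.

End TwoCharts.

(** The acceleration term of [second_derive_chart_change] is tangent to the image. To
see it as a combination of the rows of the Jacobian matrix in the chart c, it is
carried back to c by the inverse transition map. *)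
Lemma second_derive_other_chart (c d : chart R n X) p v : atlas c -> atlas d ->
  chart_cod c p -> chart_dom d (chart_inv c p) ->
  exists q u a, [/\ q = chart_map d (chart_inv c p), chart_cod d q,
    'D_v (g \o chart_inv c) p = 'D_u (g \o chart_inv d) q &
    'D_v ('D_v (g \o chart_inv c)) p =
    'D_u ('D_u (g \o chart_inv d)) q + a *m 'J (g \o chart_inv c) p].
Proof.
move=> ac ad cp ddp; have [dcp mp] := chart_codP cp.
pose q := chart_map d (chart_inv c p).
pose tau : 'rV[R]_n -> 'rV[R]_n := chart_map d \o chart_inv c.
pose tau' : 'rV[R]_n -> 'rV[R]_n := chart_map c \o chart_inv d.
have Vp : (chart_map c @` (chart_dom c `&` chart_dom d)) p.
  by exists (chart_inv c p).
have Vq : (chart_map d @` (chart_dom d `&` chart_dom c)) q.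
  by exists (chart_inv c p).
pose w : 'rV[R]_n := \row_j 'D_v ('D_v (fun q => tau q 0 j)) p.
exists q, ('D_v tau p), ('D_w tau' q); split=> //.
- by exists (chart_inv c p).
- exact: derive_chart_change.
- rewrite (second_derive_chart_change ac ad) //; congr (_ + _).
  have tq : tau' q = p by rewrite /tau' /= /q chart_mapK.
  rewrite -deriveEjacobian; last exact: smooth_map_diff.
  by have := derive_chart_change ad ac w Vq; rewrite -/tau' tq.
Qed.

End ChartChange.

(** * Uniform estimates on a compact manifold *)

Lemma sum_le_const (R : realType) (n : nat) (F : 'I_n -> R) (b : R) :
  (forall i, F i <= b) -> \sum_i F i <= n%:R * b.
Proof.
move=> Fb; apply: (@le_trans _ _ (\sum_(i < n) b)); first exact: ler_sum.
by rewrite sumr_const card_ord mulr_natl.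
Qed.

Section CompactManifold.
Variables (R : realType) (n : nat) (X : smoothManifold R n).
Hypothesis cX : closed_manifold X.

(** If F takes the same value at two distinct points near x, the function w of
[immersion_left_inverse] changes between them by minus the difference of their
coordinates, which is more than its Lipschitz constant allows. *)
Lemma immersion_locally_injective M (F : X -> 'rV[R]_M) (x : X) :
  smooth_immersion F ->
  exists2 W, nbhs x W & forall y y', W y -> W y' -> F y = F y' -> y = y'.
Proof.
move=> [sF iF]; have [d ad dx] := atlas_cover x.
pose p := chart_map d x; have cp : chart_cod d p by exact: chart_map_cod.
pose e : R := (2 * n.+1%:R)^-1.
have e0 : 0 < e by rewrite invr_gt0 mulr_gt0.
have [Q [Cw /nbhs_ballP[r /= r0 rB]]] := immersion_left_inverse (chart_codO d) cp
  (fun j => smooth_map_coord sF j 1 ad) (iF _ _ ad cp) e0.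
have nb : nbhs p (ball p r) by apply: nbhsx_ballx.
exists (fun y => chart_dom d y /\ ball p r (chart_map d y)).
  exact: chart_near dx nb.
move=> y y' [dy By] [dy' By'] Fyy'.
pose q := chart_map d y; pose q' := chart_map d y'.
pose S := \sum_k `|q 0 k - q' 0 k|.
have key i : `|q 0 i - q' 0 i| <= e * S.
  pose w (q : 'rV[R]_n) := \sum_j (F \o chart_inv d) q 0 j * Q j i - q 0 i.
  have Hw : `|w q - w q'| <= e * S.
    apply: (@partials_lipschitz R n p r w e) => // z Bz.
      by have [Uz _] := rB _ Bz; have [+ _] := Cw i; exact.
    by move=> k; have [_] := rB _ Bz; exact.
  have Eq : (F \o chart_inv d) q = F y by rewrite /= chart_mapK.
  have Eq' : (F \o chart_inv d) q' = F y by rewrite /= chart_mapK.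
  move: Hw; rewrite /w Eq Eq'; set s := \sum_j _.
  by have -> : s - q 0 i - (s - q' 0 i) = q' 0 i - q 0 i; [ring|rewrite distrC].
have S0 : S <= 0.
  have : S <= n%:R * (e * S).
    exact: sum_le_const.
  have Sg : 0 <= S by exact: sumr_ge0.
  have en : n%:R * e <= 2^-1.
    rewrite /e invfM mulrCA -[leRHS]mulr1 ler_pM2l ?invr_gt0 //.
    by rewrite ler_pdivrMr // mul1r ler_nat.
  have : n%:R * (e * S) <= 2^-1 * S by rewrite mulrA ler_wpM2r.
  lra.
rewrite -(chart_mapK dy) -(chart_mapK dy'); congr chart_inv.
apply/rowP => k; apply/eqP; rewrite -subr_eq0 -normr_le0.
apply: le_trans S0; rewrite /S (bigD1 k) //= lerDl.
by apply: sumr_ge0.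
Qed.

Lemma truncn_close (a b : R) : 0 <= a -> 0 <= b ->
  Num.truncn a = Num.truncn b -> `|a - b| <= 1.
Proof.
move=> a0 b0 ab; have /andP[] := truncn_itv a0; have /andP[] := truncn_itv b0.
rewrite ab -natr1 => *; rewrite ler_norml; apply/andP; split; lra.
Qed.

(** X is covered by finitely many coordinate cubes on which H is Lipschitz; each of
them is cut into L^n equal cubes. *)
Lemma lipschitz_cells (I : finType) (H : X -> I -> R) :
  (forall i, smooth_scalar (fun x => H x i)) ->
  exists (C0 : nat) (C1 : R), forall L, (0 < L)%N ->
    exists (T : finType) (cell : X -> T),
    (#|T| <= C0 * L ^ n)%N /\
    forall x y, cell x = cell y -> forall i, `|H x i - H y i| * L%:R <= C1.
Proof.
move=> sH.
pose good x (z : chart R n X * R * R) :=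
  [/\ chart_dom z.1.1 x, 0 < z.1.2, 0 <= z.2 &
   forall y y', chart_dom z.1.1 y -> chart_dom z.1.1 y' ->
     ball (chart_map z.1.1 x) z.1.2 (chart_map z.1.1 y) ->
     ball (chart_map z.1.1 x) z.1.2 (chart_map z.1.1 y') ->
     forall i, `|H y i - H y' i| <=
       z.2 * \sum_k `|chart_map z.1.1 y 0 k - chart_map z.1.1 y' 0 k|].
have /choice [z zP] x : exists z, good x z.
  have [d ad dx] := atlas_cover x.
  have cp : chart_cod d (chart_map d x) by exact: chart_map_cod.
  have CH i : Ck 1 (chart_cod d) ((fun x => H x i) \o chart_inv d) by exact: sH.
  have [b /nbhs_ballP[r /= r0 rB]] := near_partials_le (chart_codO d) cp CH.
  exists (d, r, `|b|); split=> //= y y' dy dy' By By' i.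
  have := @partials_lipschitz R n (chart_map d x) r
    ((fun x => H x i) \o chart_inv d) `|b| _ _ _ _ By By'.
  rewrite /= !chart_mapK //; apply.
    by move=> q /rB [cq _]; have [+ _] := CH i; exact.
  by move=> q /rB [_ +] k => /(_ i k) /le_trans; apply; exact: ler_norm.
pose W x y := chart_dom (z x).1.1 y /\
   ball (chart_map (z x).1.1 x) (z x).1.2 (chart_map (z x).1.1 y).
have [|s [_ sP]] := compact_subcover (W := W) cX.
  move=> x _; have [dx r0 _ _] := zP x.
  by apply: chart_near => //; apply: nbhsx_ballx.
have /choice [sel selP] y : exists x : seq_sub s, W (ssval x) y.
  by have [x xs Wx] := sP y Logic.I; exists (SeqSub xs).
exists #|{: seq_sub s}|, (\sum_(x : seq_sub s) `|(z (ssval x)).2 * (n%:R * (2 * (z (ssval x)).1.2))|).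
case=> [//|L] _; exists (seq_sub s * {ffun 'I_n -> 'I_L.+1})%type.
pose pos (x y : X) (k : 'I_n) : R :=
  (chart_map (z x).1.1 y 0 k - chart_map (z x).1.1 x 0 k + (z x).1.2)
    / (2 * (z x).1.2) * L.+1%:R.
exists (fun y => (sel y, [ffun k => inord (Num.truncn (pos (ssval (sel y)) y k))])).
split; first by rewrite card_prod card_ffun !card_ord.
have posP x y k : W x y -> 0 <= pos x y k < L.+1%:R.
  move=> [dy]; rewrite -ball_normE /ball_ /= => By.
  have [_ r0 _ _] := zP x.
  have := le_lt_trans (row_norm_coord _ k) By; rewrite !mxE ltr_norml.
  move=> /andP[lo hi].
  have r2 : 0 < 2 * (z x).1.2 by rewrite mulr_gt0.
  apply/andP; split.
    by rewrite mulr_ge0 // divr_ge0 ?(ltW r2) //; lra.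
  rewrite -[ltRHS]mul1r /pos ltr_pM2r // ltr_pdivrMr // mul1r; lra.
move=> y y' [ss /ffunP cc] i.
have Wy := selP y; have Wy' := selP y'; rewrite -ss in Wy' cc.
set xs := sel y in Wy Wy' cc; pose x := ssval xs; rewrite -/x in Wy Wy' cc.
have [dx r0 b0 lip] := zP x.
have posc k : `|pos x y k - pos x y' k| <= 1.
  have /andP[p0 pL] := posP _ _ k Wy; have /andP[p0' pL'] := posP _ _ k Wy'.
  apply: truncn_close => //; have := cc k; rewrite !ffunE => /(congr1 val).
  by rewrite /= !inordK // truncn_lt_nat.
rewrite (bigD1 xs) //=; apply: ler_wpDr; first by apply: sumr_ge0.
rewrite -/x [leRHS]ger0_norm; last first.
  by apply: mulr_ge0 => //; do 2!apply: mulr_ge0 => //; exact: ltW.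
case: Wy => dy By; case: Wy' => dy' By'.
apply: le_trans (ler_wpM2r (ler0n _ _) (lip _ _ dy dy' By By' i)) _.
rewrite -mulrA ler_wpM2l // mulr_suml.
apply: sum_le_const => k.
have r2 : 0 < 2 * (z x).1.2 by rewrite mulr_gt0.
have := posc k; rewrite /pos -mulrBl -mulrBl normrM normrM.
rewrite [X in _ * X * _]gtr0_norm ?invr_gt0 // [X in _ * X <= _]gtr0_norm //.
rewrite mulrAC ler_pdivrMr // mul1r; congr (`|_| * _ <= _); ring.
Qed.

(** Near a point, the second derivatives of f and H along u are at most a constant
times |u|^2, and |u| is at most a constant times |D_u f| because f is an
immersion. The bounds concern one chart per point that serves both f and H. *)
Lemma uniform_chart_bounds m (f : X -> 'rV[R]_m) (I : finType) (H : X -> I -> R) :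
  smooth_immersion f -> (forall i, smooth_scalar (fun x => H x i)) ->
  exists C : R, forall x : X, exists d, [/\ atlas d, chart_dom d x &
    forall u : 'rV[R]_n,
    [/\ forall j, `|'D_u ('D_u (fun q => (f \o chart_inv d) q 0 j)) (chart_map d x)|
          <= C * enorm ('D_u (f \o chart_inv d) (chart_map d x)) ^+ 2 &
        forall i, `|'D_u ('D_u ((fun x => H x i) \o chart_inv d)) (chart_map d x)|
          <= C * enorm ('D_u (f \o chart_inv d) (chart_map d x)) ^+ 2]].
Proof.
move=> [sf imf] sH; pose P (C : R) (x : X) := exists d, [/\ atlas d, chart_dom d x &
    forall u : 'rV[R]_n,
    [/\ forall j, `|'D_u ('D_u (fun q => (f \o chart_inv d) q 0 j)) (chart_map d x)|
          <= C * enorm ('D_u (f \o chart_inv d) (chart_map d x)) ^+ 2 &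
        forall i, `|'D_u ('D_u ((fun x => H x i) \o chart_inv d)) (chart_map d x)|
          <= C * enorm ('D_u (f \o chart_inv d) (chart_map d x)) ^+ 2]].
have [||C CP] := @compact_uniform R X setT P cX; last by exists C => x; exact: (CP x Logic.I).
  move=> C C' x CC [d [ad dx dP]]; exists d; split=> // u.
  have [A B] := dP u; have mono y : 0 <= y -> C * y <= C' * y by move=> y0; exact: ler_wpM2r.
  split=> [j|i]; first exact: le_trans (A j) (mono _ (sqr_ge0 _)).
  exact: le_trans (B i) (mono _ (sqr_ge0 _)).
move=> x _; have [d ad dx] := atlas_cover x.
have cp : chart_cod d (chart_map d x) by exact: chart_map_cod.
pose e : R := (2 * n.+1%:R)^-1.
have e0 : 0 < e by rewrite invr_gt0 mulr_gt0.
pose G := f \o chart_inv d.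
have CG j k : Ck k (chart_cod d) (fun q => G q 0 j).
  exact: (smooth_map_coord sf j k ad).
have [Q [Cw nQ]] := immersion_left_inverse (chart_codO d) cp
  (fun j => CG j 1%N) (imf _ _ ad cp) e0.
have [b1 nb1] := near_partials_le (h := fun jk : 'I_m * 'I_n =>
    'D_'e_(jk.2) (fun q => G q 0 jk.1)) (chart_codO d) cp
  (fun jk => (CG jk.1 2%N).2 'e_(jk.2)).
have CH i k : Ck k (chart_cod d) ((fun x => H x i) \o chart_inv d) by exact: sH.
have [b2 nb2] := near_partials_le (h := fun ik : I * 'I_n =>
    'D_'e_(ik.2) ((fun x => H x ik.1) \o chart_inv d)) (chart_codO d) cp
  (fun ik => (CH ik.1 2%N).2 'e_(ik.2)).
pose N : R := 2 * \sum_(i < n) \sum_(j < m) `|Q j i|.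
have N0 : 0 <= N.
  by rewrite mulr_ge0 //; apply: sumr_ge0 => i _; apply: sumr_ge0.
exists ((`|b1| + `|b2|) * N ^+ 2).
have N1 : nbhs (chart_map d x) [set q | chart_cod d q /\ forall u : 'rV[R]_n,
    [/\ forall j, `|'D_u ('D_u (fun q => G q 0 j)) q|
          <= (`|b1| + `|b2|) * N ^+ 2 * enorm ('D_u G q) ^+ 2 &
        forall i, `|'D_u ('D_u ((fun x => H x i) \o chart_inv d)) q|
          <= (`|b1| + `|b2|) * N ^+ 2 * enorm ('D_u G q) ^+ 2]].
  move: nQ nb1 nb2; apply: filterS3 => q [cq qQ] [_ qb1] [_ qb2].
  split=> // u.
  pose S := \sum_k `|u 0 k|; have S0 : 0 <= S by exact: sumr_ge0.
  have dGj j : differentiable (fun q => G q 0 j) q.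
    by have [+ _] := CG j 1%N; exact.
  have dG : differentiable G q by apply/differentiable_rowP.
  (* The l^1 norm S of u is controlled by D_u G: the matrix Q recovers u from D_u G up to
     an error of at most S / 2. *)
  have SN : S <= N * enorm ('D_u G q).
    have key i : `|u 0 i| <= \sum_j `|Q j i| * enorm ('D_u G q) + e * S.
      pose w q := \sum_j G q 0 j * Q j i - q 0 i.
      have dw : differentiable w q by have [+ _] := Cw i; exact.
      have wE : 'D_u w q = \sum_j ('D_u G q) 0 j * Q j i - u 0 i.
        by have [_ ->] := is_deriveB (is_derive_lincomb (fun j => Q j i) u dG)
          (is_derive_coord q u i).
      have le1 : `|'D_u w q| <= e * S.
        rewrite derive_partials // (le_trans (ler_norm_sum _ _ _)) //.
        rewrite mulr_sumr; apply: ler_sum => k _.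
        by rewrite normrM mulrC ler_wpM2r //; exact: qQ.
      have -> : u 0 i = \sum_j ('D_u G q) 0 j * Q j i - 'D_u w q.
        by rewrite wE opprB addrC subrK.
      apply: le_trans (ler_normB _ _) _; apply: lerD => //.
      apply: le_trans (ler_norm_sum _ _ _) _; apply: ler_sum => j _.
      by rewrite normrM mulrC ler_wpM2l // enorm_coord.
    have : S <= \sum_(i < n) (\sum_(j < m) `|Q j i| * enorm ('D_u G q) + e * S).
      by apply: ler_sum.
    rewrite big_split /= sumr_const card_ord -mulr_natl.
    have en : n%:R * e <= 2^-1.
      rewrite /e invfM mulrCA -[leRHS]mulr1 ler_pM2l ?invr_gt0 //.
      by rewrite ler_pdivrMr // mul1r ler_nat.
    have : n%:R * (e * S) <= 2^-1 * S by rewrite mulrA ler_wpM2r.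
    have -> : N * enorm ('D_u G q) =
       2 * \sum_(i < n) \sum_(j < m) `|Q j i| * enorm ('D_u G q).
      rewrite /N -mulrA mulr_suml; congr (_ * _); apply: eq_bigr => i _.
      by rewrite mulr_suml.
    lra.
  have SN2 : S ^+ 2 <= N ^+ 2 * enorm ('D_u G q) ^+ 2.
    have NE : 0 <= N * enorm ('D_u G q) by exact: mulr_ge0 N0 (enorm_ge0 _).
    by rewrite -exprMn ler_sqr ?nnegrE.
  split=> [j|i].
    apply: le_trans (second_derive_le (b := `|b1|) u (chart_codO d) cq (CG j 2%N) _) _.
      by move=> k l; apply: le_trans (ler_norm b1); exact: (qb1 (j, k) l).
    rewrite -/S -mulrA; apply: ler_pM => //; first exact: sqr_ge0.
    by rewrite lerDl.
  apply: le_trans (second_derive_le (b := `|b2|) u (chart_codO d) cq (CH i 2%N) _) _.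
    by move=> k l; apply: le_trans (ler_norm b2); exact: (qb2 (i, k) l).
  rewrite -/S -mulrA; apply: ler_pM => //; first exact: sqr_ge0.
  by rewrite lerDr.
apply: filterS (@chart_near _ _ _ d x _ dx N1) => y [dy [cy yP]].
by exists d; split.
Qed.

End CompactManifold.

(** * Separating pairs of points by counting integer matrices *)

Section Counting.
Variable R : realType.

(** If all the a_j but a_(j0) are fixed, the admissible values of a_(j0) lie in an
interval with at most q integers, so they are determined by their class modulo q.
The injection below records this class and stores the arbitrary l in the place of
a_(j0). *)
Lemma card_small_combinations (K L q : nat) (v : 'I_K -> R) (j0 : 'I_K) (b c : R) :
  0 < c -> c <= `|v j0| -> 2 * b < c * q%:R ->
  (#|[set a : {ffun 'I_K -> 'I_L} | (`|\sum_j (a j)%:R * v j| <= b)%R]%SET| * L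
     <= L ^ K * q)%N.
Proof.
move=> c0 cv bq; set S := [set a | _]%SET.
have [q0|q0] := posnP q.
  rewrite q0 mulr0 in bq; have b0 : b < 0 by lra.
  rewrite (_ : S = finset.set0) ?cards0 //; apply/setP => a; rewrite !inE.
  by apply/negbTE; rewrite -ltNge; apply: lt_le_trans b0 _.
pose put (a : {ffun 'I_K -> 'I_L}) l := [ffun j => if j == j0 then l else a j].
pose F (x : {ffun 'I_K -> 'I_L} * 'I_L) : {ffun 'I_K -> 'I_L} * 'I_q :=
  (put x.1 x.2, Ordinal (ltn_pmod (x.1 j0) q0)).
rewrite -[X in (_ * X)%N]card_ord -[X in (_ <= _ * X)%N]card_ord.
rewrite -[X in (_ <= X ^ _ * _)%N]card_ord -[X in (_ <= _ ^ X * _)%N]card_ord.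
rewrite -card_ffun -card_prod -[X in (_ * X <= _)%N]cardsT -cardsX.
rewrite -(@card_in_imset _ _ F); first exact: max_card.
move=> [a l] [a' l']; rewrite !inE /= !andbT => Sa Sa' [e em].
have el : l = l' by have := congr1 (fun g : {ffun _} => g j0) e; rewrite !ffunE eqxx.
subst l'; congr (_, _); apply/ffunP => j.
have same i : i != j0 -> a i = a' i.
  move=> ij; have := congr1 (fun g : {ffun _} => g i) e.
  by rewrite !ffunE (negbTE ij).
have [->|/same//] := eqVneq j j0.
apply: val_inj => /=; move: em => /= em.
pose x : R := (a j0)%:R; pose y : R := (a' j0)%:R.
have xy : `|x - y| * c < c * q%:R.
  apply: le_lt_trans bq; apply: le_trans (_ : `|x - y| * `|v j0| <= _).
    by rewrite ler_wpM2l.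
  have -> : `|x - y| * `|v j0| =
      `|\sum_j (a j)%:R * v j - \sum_j (a' j)%:R * v j|.
    rewrite -normrM -sumrB (bigD1 j0) //= big1 ?addr0.
      by rewrite mulrBl.
    by move=> i /same ->; rewrite subrr.
  by rewrite mulr_natl mulr2n (le_trans (ler_normB _ _)) // lerD.
have {}xy : `|x - y| < q%:R by rewrite -(ltr_pM2r c0) [q%:R * _]mulrC.
rewrite /x /y in xy.
wlog lt : a a' {Sa Sa' e same x y} em xy / (a' j0 <= a j0)%N.
  move=> H; case/orP: (leq_total (a' j0) (a j0)) => h; first exact: (H a a').
  by apply/esym/(H a' a) => //; rewrite distrC.
rewrite -natrB // ger0_norm ?ler0n // ltr_nat in xy.
have : (a j0 == a' j0 %[mod q]) by rewrite em.
rewrite eqn_mod_dvd // => /dvdn_leq qle.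
case: (posnP (a j0 - a' j0)%N) => [/eqP|/qle]; last by rewrite leqNgt xy.
by rewrite subn_eq0 => le; apply/eqP; rewrite eqn_leq; apply/andP.
Qed.

Lemma card_bigcup_le (I T : finType) (B : {set I}) (F : I -> {set T}) :
  (#|(\bigcup_(p in B) F p)%SET| <= \sum_(p in B) #|F p|)%N.
Proof.
elim/big_rec2: _ => [|p k A _ IH]; first by rewrite cards0.
by rewrite (leq_trans (leq_card_setU _ _)) // leq_add2l.
Qed.

(** Cut X into at most C0 L^d cells of diameter O(1/L). There are at most C0^2 L^(2d)
pairs of cells that meet D, and each is represented by a difference of values of
H whose coordinates are not all small. For a fixed pair, the proportion of the
vectors in {0, ..., L-1}^K that are almost orthogonal to this difference is
O(1/L), so the proportion of s-tuples of such vectors is O(L^(-s)). As s > 2d, for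
large L there is an s-tuple that contains, for each pair of cells, a vector not
almost orthogonal to its difference. The cells are small enough to pass from the
representative to all points of the pair of cells. *)
Lemma separating_projection (X : Type) (K s d C0 : nat) (H : X -> 'I_K -> R)
    (D : X -> X -> Prop) (C1 c : R) : 0 < c -> (2 * d < s)%N ->
  (forall x y, D x y -> exists j, c <= `|H x j - H y j|) ->
  (forall L, (0 < L)%N -> exists (T : finType) (cell : X -> T),
     (#|T| <= C0 * L ^ d)%N /\
     forall x y, cell x = cell y -> forall j, `|H x j - H y j| * L%:R <= C1) ->
  exists A : 'I_s -> 'I_K -> R,
    forall x y, D x y -> exists r, \sum_j A r j * (H x j - H y j) != 0.
Proof.
move=> c0 ds sep cells.
(* If two points vary in their cells, each combination with coefficients at most L
   varies by at most b. *)
pose b : R := K%:R * (2 * C1).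
have [q qb] : exists q : nat, 2 * b < c * q%:R.
  exists (Num.bound `|2 * b / c|); rewrite [c * _]mulrC -ltr_pdivrMr //.
  exact: le_lt_trans (ler_norm _) (archi_boundP (normr_ge0 _)).
pose L := (C0 ^ 2 * q ^ s).+1.
have [T [cell [cT cellP]]] := cells L isT.
pose rep (p : T * T) (z : X * X) :=
  [/\ D z.1 z.2, cell z.1 = p.1 & cell z.2 = p.2].
pose B := [set p : T * T | `[< exists z, rep p z >]]%SET.
have /choice [v vP] (p : T * T) : exists v : 'I_K -> R, p \in B ->
   exists2 z, rep p z & v = fun j => H z.1 j - H z.2 j.
  case: (boolP (p \in B)) => [|_]; last by exists (fun=> 0).
  by rewrite inE => /asboolP [z zp]; exists (fun j => H z.1 j - H z.2 j) => _; exists z.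
pose S p := [set a : {ffun 'I_K -> 'I_L} | (`|\sum_j (a j)%:R * v p j| <= b)%R]%SET.
have cS p : p \in B -> (#|S p| * L <= L ^ K * q)%N.
  move=> /vP [z [zD _ _] vE]; have [j0 j0P] := sep _ _ zD.
  by apply: (@card_small_combinations K L q (v p) j0 b c) => //; rewrite vE.
have [A AP] : exists A : {ffun 'I_s -> {ffun 'I_K -> 'I_L}},
    forall p, p \in B -> exists r, A r \notin S p.
  apply: contrapT => noA.
  have cover (A : {ffun 'I_s -> {ffun 'I_K -> 'I_L}}) :
      A \in (\bigcup_(p in B) [set A | A \in ffun_on (mem (S p))])%SET.
    have [p pB pA] : exists2 p, p \in B & forall r, A r \in S p.
      apply: contrapT => nop; apply: noA; exists A => p pB.
      apply: contrapT => nor; apply: nop; exists p => // r.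
      by apply: contrapT => /negP nr; apply: nor; exists r.
    apply/finset.bigcupP; by exists p => //; rewrite inE; apply/ffun_onP.
  have : ((L ^ K) ^ s <= \sum_(p in B) #|S p| ^ s)%N.
    apply: leq_trans (_ : #|[set: {ffun 'I_s -> {ffun 'I_K -> 'I_L}}]%SET| <= _)%N.
      by rewrite cardsT !card_ffun !card_ord.
    apply: leq_trans (_ : \sum_(p in B) #|[set A in ffun_on (mem (S p))]%SET| <= _)%N.
      apply: leq_trans (card_bigcup_le B (fun p => [set A in ffun_on (mem (S p))]%SET)).
      by apply: subset_leq_card; apply/fintype.subsetP => A _; exact: cover.
    by apply: leq_sum => p _; rewrite cardsE card_ffun_on card_ord.
  move=> H1.
  have : ((L ^ K) ^ s * L ^ s <= #|T| ^ 2 * (L ^ K * q) ^ s)%N.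
    apply: leq_trans (_ : (\sum_(p in B) #|S p| ^ s) * L ^ s <= _)%N.
      by rewrite leq_mul2r H1 orbT.
    rewrite big_distrl /=.
    apply: leq_trans (_ : \sum_(p in B) (L ^ K * q) ^ s <= _)%N.
      by apply: leq_sum => p pB; rewrite -expnMn leq_exp2r ?cS //; lia.
    rewrite sum_nat_const leq_mul2r -mulnn -card_prod max_card orbT //.
  rewrite expnMn mulnCA leq_pmul2l; last by rewrite !expn_gt0.
  apply/negP; rewrite -ltnNge.
  apply: leq_ltn_trans (_ : C0 ^ 2 * q ^ s * L ^ (2 * d) < _)%N.
    rewrite [leqRHS]mulnAC leq_mul2r; apply/orP; right.
    by rewrite [X in (_ * L ^ X)%N]mulnC expnM -expnMn leq_exp2r.
  apply: leq_trans (_ : L ^ (2 * d).+1 <= _)%N; last by rewrite leq_pexp2l.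
  by rewrite [(L ^ _.+1)%N]expnS ltn_pmul2r // expn_gt0.
exists (fun r j => (A r j)%:R) => x y Dxy.
pose p := (cell x, cell y).
have pB : p \in B by rewrite inE; apply/asboolP; exists (x, y).
have [r rP] := AP p pB; exists r; move: rP; rewrite inE -ltNge.
have [[x' y'] [/= _ xx' yy'] vE] := vP p pB.
apply: contraTneq => e; rewrite -leNgt.
have -> : \sum_j (A r j)%:R * v p j =
   \sum_j (A r j)%:R * ((H x' j - H x j) - (H y' j - H y j)).
  transitivity (\sum_j (A r j)%:R * v p j - \sum_j (A r j)%:R * (H x j - H y j)).
    by rewrite e subr0.
  by rewrite -sumrB; apply: eq_bigr => j _; rewrite vE /=; ring.
apply: le_trans (ler_norm_sum _ _ _) _.
rewrite /b -[K in K%:R]card_ord -sum1_card natr_sum mulr_suml.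
apply: ler_sum => j _; rewrite mul1r normrM ger0_norm //.
apply: le_trans (_ : L%:R * (`|H x' j - H x j| + `|H y' j - H y j|) <= _).
  by apply: ler_pM => //; [rewrite ler_nat ltnW|exact: ler_normB].
have := cellP _ _ xx' j; have := cellP _ _ yy' j; lra.
Qed.
End Counting.

(** * The torus map *)

Section TorusMap.
Variables (R : realType) (m N : nat) (a : 'I_N -> R) (s : 'I_N -> 'I_m -> R).
Variable kappa2 : R.
Hypothesis a1 : \sum_i a i ^+ 2 = 1.
Hypothesis s2 : forall t : 'I_m -> R,
  \sum_i a i ^+ 2 * (\sum_j s i j * t j) ^+ 2 = \sum_j t j ^+ 2.
Hypothesis s4 : forall t : 'I_m -> R,
  \sum_i a i ^+ 2 * (\sum_j s i j * t j) ^+ 4 = kappa2 * (\sum_j t j ^+ 2) ^+ 2.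

Let S : 'M[R]_(m, N) := \matrix_(j, i) s i j.

(** The summands with coefficient 0 put both halves into the common form
a cos + b sin of [derive_sincos]. *)
Definition torus_map (y : 'rV[R]_m) : 'rV[R]_(N + N) :=
  row_mx (\row_i (a i * cos ((y *m S) 0 i) + 0 * sin ((y *m S) 0 i)))
         (\row_i (0 * cos ((y *m S) 0 i) + a i * sin ((y *m S) 0 i))).

Lemma enorm_torus_map y : enorm (torus_map y) = 1.
Proof.
apply/eqP; rewrite -(@eqrXn2 _ 2) ?enorm_ge0 // expr1n sqr_enorm_row_mx !sqr_enorm.
rewrite -big_split /= -a1; apply/eqP; apply: eq_bigr => i _; rewrite !mxE.
have := cos2Dsin2 ((y *m S) 0 i); rewrite mxE; set c := cos _; set d := sin _ => cd.
by rewrite -[RHS]mulr1 -cd; ring.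
Qed.

Lemma mulmx_S (y : 'rV[R]_m) i : (y *m S) 0 i = \sum_j s i j * y 0 j.
Proof. by rewrite mxE; apply: eq_bigr => j _; rewrite mxE mulrC. Qed.

Variables (n : nat) (U : set 'rV[R]_n) (F : 'rV[R]_n -> 'rV[R]_m).
Hypothesis oU : open U.

Lemma Ck_row_torus_map k : Ck_row k U F -> Ck_row k U (torus_map \o F).
Proof.
move=> CF; have CS := Ck_row_mulmx S oU CF.
apply: Ck_row_row_mx => i; [have C := C1k_sincos k (a i) 0|have C := C1k_sincos k 0 (a i)];
 have := Ck_comp1 oU C (CS i); by apply: Ck_ext => // q _; rewrite mxE.
Qed.

Variable p : 'rV[R]_n.
Hypothesis Up : U p.

Lemma torus_map_isometric v : Ck_row 1 U F ->
  enorm ('D_v (torus_map \o F) p) ^+ 2 = enorm ('D_v F p) ^+ 2.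
Proof.
move=> CF; have CS := Ck_row_mulmx S oU CF.
have dF := Ck_row_diff CF Up; have dFS := Ck_row_diff CS Up.
have dT := Ck_row_diff (Ck_row_torus_map CF) Up.
have dy i : differentiable (fun q => (F q *m S) 0 i) p by have [+ _] := CS i; exact.
have YE i : 'D_v (fun q => (F q *m S) 0 i) p = \sum_j s i j * ('D_v F p) 0 j.
  by rewrite -derive_row // derive_mulmx // mulmx_S.
rewrite !sqr_enorm -[RHS]s2 big_split_ord /= -big_split /=; apply: eq_bigr => i _.
rewrite !derive_row //.
have -> : (fun q => (torus_map \o F) q 0 (lshift N i)) =
   (fun q => a i * cos ((F q *m S) 0 i) + 0 * sin ((F q *m S) 0 i)).
  by apply/funext => q; rewrite /= row_mxEl mxE.
have -> : (fun q => (torus_map \o F) q 0 (rshift N i)) =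
   (fun q => 0 * cos ((F q *m S) 0 i) + a i * sin ((F q *m S) 0 i)).
  by apply/funext => q; rewrite /= row_mxEr mxE.
rewrite !derive_sincos // YE.
have := cos2Dsin2 ((F p *m S) 0 i); set c := cos _; set d := sin _ => cd.
by set Y := \sum_j _; rewrite -[RHS]mulr1 -cd; ring.
Qed.

(** For each i the centripetal and the tangential accelerations in the i-th circle are
orthogonal; the fourth moment adds up the former and the second moment the
latter. *)
Lemma torus_map_second_derivative v : Ck_row 2 U F ->
  enorm ('D_v ('D_v (torus_map \o F)) p) ^+ 2 =
  kappa2 * enorm ('D_v F p) ^+ 4 + enorm ('D_v ('D_v F) p) ^+ 2.
Proof.
move=> CF; have CS := Ck_row_mulmx S oU CF.
have dF := Ck_row_diff CF Up; have CT := Ck_row_torus_map CF.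
have YE i : 'D_v (fun q => (F q *m S) 0 i) p = \sum_j s i j * ('D_v F p) 0 j.
  have dFS := Ck_row_diff CS Up.
  by rewrite -derive_row // derive_mulmx // mulmx_S.
have ZE i : 'D_v ('D_v (fun q => (F q *m S) 0 i)) p =
    \sum_j s i j * ('D_v ('D_v F) p) 0 j.
  by rewrite -(second_derive_row v v i oU Up CS) (second_derive_mulmx S v oU Up CF) mulmx_S.
have WL i : ('D_v ('D_v (torus_map \o F)) p) 0 (lshift N i) =
    - (a i * cos ((F p *m S) 0 i)) * (\sum_j s i j * ('D_v F p) 0 j) ^+ 2
    - a i * sin ((F p *m S) 0 i) * \sum_j s i j * ('D_v ('D_v F) p) 0 j.
  rewrite (second_derive_row v v _ oU Up CT).
  have -> : (fun q => (torus_map \o F) q 0 (lshift N i)) =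
     (fun q => a i * cos ((F q *m S) 0 i) + 0 * sin ((F q *m S) 0 i)).
    by apply/funext => q; rewrite /= row_mxEl mxE.
  rewrite (second_derive_sincos (a i) 0 v oU Up (CS i)) YE ZE.
  by rewrite !mul0r addr0 sub0r; congr (_ + _); rewrite mulNr.
have WR i : ('D_v ('D_v (torus_map \o F)) p) 0 (rshift N i) =
    - (a i * sin ((F p *m S) 0 i)) * (\sum_j s i j * ('D_v F p) 0 j) ^+ 2
    + a i * cos ((F p *m S) 0 i) * \sum_j s i j * ('D_v ('D_v F) p) 0 j.
  rewrite (second_derive_row v v _ oU Up CT).
  have -> : (fun q => (torus_map \o F) q 0 (rshift N i)) =
     (fun q => 0 * cos ((F q *m S) 0 i) + a i * sin ((F q *m S) 0 i)).
    by apply/funext => q; rewrite /= row_mxEr mxE.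
  rewrite (second_derive_sincos 0 (a i) v oU Up (CS i)) YE ZE.
  by rewrite !mul0r add0r subr0.
move: WL WR; move: ('D_v ('D_v (torus_map \o F)) p) ('D_v ('D_v F) p) ('D_v F p).
move=> W D2 D1 WL WR; rewrite (exprM (enorm D1) 2 2) !sqr_enorm.
rewrite -[X in _ = _ * X + _]/((\sum_j D1 0 j ^+ 2) ^+ 2) -s4 -[X in _ = _ + X]s2.
rewrite big_split_ord /= -!big_split /=; apply: eq_bigr => i _; rewrite WL WR.
have := cos2Dsin2 ((F p *m S) 0 i); move: (cos _) (sin _) => c d cd.
move: (\sum_j s i j * D1 0 j) (\sum_j s i j * D2 0 j) => Y Z.
by rewrite -[RHS]mul1r -cd; ring.
Qed.

End TorusMap.

(** * Smooth maps, immersions and curvature *)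

Section MapsOnManifolds.
Variables (R : realType) (n : nat) (X : smoothManifold R n).

Lemma smooth_map_Ck_row m (f : X -> 'rV[R]_m) : smooth_map f <->
  forall c, atlas c -> forall k, Ck_row k (chart_cod c) (f \o chart_inv c).
Proof.
split=> [sf c ac k j|sf].
  by have /smooth_mapP := sf => /(_ j c ac k).
by apply/smooth_mapP => j c ac k; exact: sf.
Qed.

Lemma smooth_map_mulmx m l (f : X -> 'rV[R]_m) (T : 'M[R]_(m, l)) :
  smooth_map f -> smooth_map (fun x => f x *m T).
Proof.
move=> /smooth_map_Ck_row sf; apply/smooth_map_Ck_row => c ac k.
exact: (Ck_row_mulmx T (chart_codO c) (sf c ac k)).
Qed.

Lemma smooth_map_row_mx m1 m2 (f : X -> 'rV[R]_m1) (g : X -> 'rV[R]_m2) :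
  smooth_map f -> smooth_map g -> smooth_map (fun x => row_mx (f x) (g x)).
Proof.
move=> /smooth_map_Ck_row sf /smooth_map_Ck_row sg.
by apply/smooth_map_Ck_row => c ac k; exact: (Ck_row_row_mx (sf c ac k) (sg c ac k)).
Qed.

Lemma smooth_map_torus m N (a : 'I_N -> R) (s : 'I_N -> 'I_m -> R)
    (f : X -> 'rV[R]_m) :
  smooth_map f -> smooth_map (torus_map a s \o f).
Proof.
move=> /smooth_map_Ck_row sf; apply/smooth_map_Ck_row => c ac k.
exact: (Ck_row_torus_map a s (chart_codO c) (sf c ac k)).
Qed.

Lemma smooth_map_continuous m (f : X -> 'rV[R]_m) : smooth_map f -> continuous f.
Proof.
move=> /smooth_mapP sf x; apply/continuous_rowP => j.
exact: (smooth_scalar_continuous (sf j)).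
Qed.

(** A vector killed by the differential of g is killed by that of f. *)
Lemma immersion_dominated m M (f : X -> 'rV[R]_m) (g : X -> 'rV[R]_M) (b : R) :
  smooth_immersion f -> smooth_map g -> 0 < b ->
  (forall c q u, atlas c -> chart_cod c q ->
    b * enorm ('D_u (f \o chart_inv c) q) ^+ 2 <=
    enorm ('D_u (g \o chart_inv c) q) ^+ 2) ->
  smooth_immersion g.
Proof.
move=> [sf imf] sg b0 dom; split=> // c q ac cq u v guv.
have df := smooth_map_diff sf ac cq; have dg := smooth_map_diff sg ac cq.
apply: (imf c q ac cq); apply/eqP; rewrite -subr_eq0 -linearB; apply/eqP.
apply: enorm0_eq0; apply/eqP; rewrite -sqrf_eq0 eq_le sqr_ge0 andbT.
have := dom c q (u - v) ac cq; rewrite !deriveE //.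
have -> : 'd (g \o chart_inv c) q (u - v) = 0 by rewrite linearB /= guv subrr.
by rewrite enorm0 expr0n /= pmulr_rle0.
Qed.

Lemma immersion_dim_le m (f : X -> 'rV[R]_m) (x : X) :
  smooth_immersion f -> (n <= m)%N.
Proof.
move=> [_ imf]; have [d ad dx] := atlas_cover x.
have cp : chart_cod d (chart_map d x) by exact: chart_map_cod.
have := injective_diff_row_free (imf d _ ad cp).
by move=> /eqP <-; exact: rank_leq_col.
Qed.

(** A continuous map from a compact space to a Hausdorff space is closed, and an
injective closed map is a homeomorphism onto its image. *)
Lemma injective_immersion_embedding m (g : X -> 'rV[R]_m) : closed_manifold X ->
  smooth_immersion g -> injective g -> smooth_embedding g.
Proof.
move=> cX ig injg; split=> // U oU; exists (~` (g @` (~` U))).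
  apply: closed_openC; apply: compact_closed; first exact: norm_hausdorff.
  apply: continuous_compact.
    by apply: continuous_subspaceT; apply: smooth_map_continuous; case: ig.
  by apply: (subclosed_compact _ cX) => //; exact: open_closedC.
apply/seteqP; split=> x /=; first by move=> Ux [y nUy /injg yx]; apply: nUy; rewrite yx.
by move=> H; apply: contrapT => nUx; apply: H; exists x.
Qed.

(** It suffices to bound the whole second derivative, and in one chart around each
point. *)
Lemma curv_perp_le m (g : X -> 'rV[R]_m) (k : R) : smooth_map g ->
  (forall x, exists2 d, atlas d & chart_dom d x /\ forall u,
    enorm ('D_u (g \o chart_inv d) (chart_map d x)) = 1 ->
    enorm ('D_u ('D_u (g \o chart_inv d)) (chart_map d x)) <= k) ->
  (curv_perp g <= k%:E)%E.
Proof.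
move=> sg H; apply: ge_ereal_sup => _ [c [p [v [ac cp gv ->]]]].
rewrite lee_fin; have [d ad [ddp Hd]] := H (chart_inv c p).
have [q [u [b [qE cq D1 D2]]]] := second_derive_other_chart sg v ac ad cp ddp.
rewrite /second_fundamental_form /normal_proj.
apply: le_trans (enorm_normal_proj_le _ _ (- b)) _.
rewrite D2 mulNmx addrK; move: Hd; rewrite -qE; apply.
by rewrite -D1 (deriveE _ (smooth_map_diff sg ac cp)).
Qed.

Hypothesis cX : closed_manifold X.

Lemma injective_smooth_map :
  exists (K : nat) (H : X -> 'rV[R]_K), smooth_map H /\ injective H.
Proof.
have [I [H [sH injH]]] := injective_coordinates cX.
exists #|I|, (fun x => \row_k H x (enum_val k)); split.
  apply/smooth_mapP => j.
  have -> : (fun x => (\row_k H x (enum_val k)) 0 j) = (fun x => H x (enum_val j)).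
    by apply/funext => x; rewrite mxE.
  exact: sH.
move=> x y /rowP e; apply: injH => i.
by have := e (enum_rank i); rewrite !mxE enum_rankK.
Qed.

(** The set of the pairs in question is compact, because F is injective near each
point, so that the diagonal has a neighbourhood without such pairs. *)
Lemma separated_off_diagonal M K (F : X -> 'rV[R]_M) (H : X -> 'rV[R]_K) :
  smooth_immersion F -> smooth_map H -> injective H ->
  exists2 c : R, 0 < c & forall x y, F x = F y -> x <> y ->
    exists j, c <= `|H x 0 j - H y 0 j|.
Proof.
move=> iF sH injH.
have cXX : compact [set: X * X] by rewrite -setXTT; exact: compact_setX.
pose P (C : R) (z : X * X) := F z.1 = F z.2 -> z.1 <> z.2 ->
  exists j, 1 <= C * `|H z.1 0 j - H z.2 0 j|.
have [||C CP] := @compact_uniform R _ _ P cXX.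
- move=> C C' z CC Pz Fz nz; have [j jP] := Pz Fz nz; exists j.
  by apply: le_trans jP _; rewrite ler_wpM2r.
- move=> [x y] _; have [<-|nxy] := pselect (x = y).
    have [W nW Winj] := immersion_locally_injective x iF.
    exists 0; exists (W, W); first by split.
    by move=> [x' y'] [/= Wx Wy] Fxy []; exact: Winj.
  have [j nj] : exists j, H x 0 j - H y 0 j != 0.
    apply: contrapT => no; apply: nxy; apply: injH; apply/rowP => j.
    apply/eqP; rewrite -subr_eq0; apply: contrapT => /negP nz.
    by apply: no; exists j.
  pose c := `|H x 0 j - H y 0 j| / 2.
  have c0 : 0 < c by rewrite divr_gt0 // normr_gt0.
  exists c^-1.
  have cont : {for (x, y), continuous (fun z : X * X => `|H z.1 0 j - H z.2 0 j|)}.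
    have /smooth_mapP sHc := sH.
    have cH := smooth_scalar_continuous (sHc j).
    apply: continuous_comp; last exact: norm_continuous.
    apply: continuousB.
      by apply: (@continuous_comp _ _ _ fst (fun x => H x 0 j)); [exact: cvg_fst|exact: cH].
    by apply: (@continuous_comp _ _ _ snd (fun x => H x 0 j)); [exact: cvg_snd|exact: cH].
  have lt : c < `|H x 0 j - H y 0 j|.
    by rewrite /c ltr_pdivrMr // ltr_pMr ?normr_gt0 // ltr1n.
  have N : nbhs (x, y) [set z : X * X | c < `|H z.1 0 j - H z.2 0 j|].
    exact: (cont [set t | c < t] (open_nbhs_nbhs (conj (@open_gt _ c) lt))).
  suff : nbhs (x, y) [set z | P c^-1 z] by [].
  apply: filterS N => -[x' y'] /= ltc _ _; exists j.
  by rewrite ler_pdivlMl // mulr1 ltW.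
exists (`|C| + 1)^-1; first by rewrite invr_gt0 ltr_wpDl.
move=> x y Fxy nxy; have [j jP] := CP (x, y) Logic.I Fxy nxy; exists j.
rewrite -[leLHS]mulr1 ler_pdivrMl ?ltr_wpDl //; apply: le_trans jP _.
by rewrite ler_wpM2r // (le_trans (ler_norm C)) // lerDl.
Qed.

(** The hypothesis on dimensions is only asked for when X has a point: the dimension of
an empty manifold is arbitrary. *)
Lemma generic_projection M K s (F : X -> 'rV[R]_M) (H : X -> 'rV[R]_K) :
  smooth_immersion F -> smooth_map H -> injective H ->
  (forall x : X, (2 * n < s)%N) ->
  exists A : 'M[R]_(K, s), forall x y, F x = F y -> H x *m A = H y *m A -> x = y.
Proof.
move=> iF sH injH ns.
have [[x0]|noX] := pselect (inhabited X); last first.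
  by exists 0 => x; case: noX; exists.
have [c c0 sep] := separated_off_diagonal iF sH injH.
have /smooth_mapP sHc := sH.
have [C0 [C1 cells]] := lipschitz_cells cX (H := fun x j => H x 0 j) sHc.
have [|A AP] := @separating_projection R X K s n C0 (fun x j => H x 0 j)
  (fun x y => F x = F y /\ x <> y) C1 c c0 (ns x0) _ cells.
  by move=> x y [Fxy nxy]; exact: sep.
exists (\matrix_(j, r) A r j) => x y Fxy HA; apply: contrapT => nxy.
have [r /eqP[]] := AP x y (conj Fxy nxy).
have /rowP/(_ r) := HA; rewrite !mxE => /eqP; rewrite -subr_eq0 -sumrB => /eqP {2}<-.
by apply: eq_bigr => j _; rewrite !mxE; ring.
Qed.

End MapsOnManifolds.

(** * The choice of the scales and the theorem *)

(** The torus map needs 2N coordinates and the separating map 2m + 1. *)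
Lemma coordinate_count (m N : nat) : (0 < m)%N -> (N <= 4 * m ^ 2 + m)%N ->
  (N + N + (2 * m).+1 <= 16 * m ^ 2 + 16 * m)%N.
Proof. by rewrite -mulnn; lia. Qed.

Section FinalEstimates.
Variable R : realType.

Lemma enorm_pid_mx (k M : nat) (v : 'rV[R]_k) : (k <= M)%N ->
  enorm (v *m (pid_mx k : 'M[R]_(k, M))) = enorm v.
Proof.
move=> kM; have sq l (w : 'rV[R]_l) : enorm w ^+ 2 = (w *m w^T) 0 0.
  by rewrite sqr_enorm mxE; apply: eq_bigr => j _; rewrite mxE expr2.
apply/eqP; rewrite -(@eqrXn2 _ 2) ?enorm_ge0 // !sq trmx_mul mulmxA.
by rewrite -(mulmxA v) tr_pid_mx pid_mx_id // pid_mx_1 mulmx1.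
Qed.

Lemma enorm_mulmx_le (k l : nat) (A : 'M[R]_(k, l)) :
  exists2 b : R, 0 <= b & forall v : 'rV[R]_k, enorm (v *m A) <= b * enorm v.
Proof.
exists (\sum_r \sum_i `|A i r|) => [|v].
  by apply: sumr_ge0 => r _; exact: sumr_ge0.
apply: le_trans (enorm_le_sum _) _; rewrite mulr_suml; apply: ler_sum => r _.
rewrite mxE (le_trans (ler_norm_sum _ _ _)) // mulr_suml; apply: ler_sum => i _.
by rewrite normrM mulrC ler_wpM2l // enorm_coord.
Qed.

Lemma sqr_enorm_le_coord (k : nat) (v : 'rV[R]_k) (b : R) :
  (forall j, `|v 0 j| <= b) -> enorm v ^+ 2 <= k%:R * b ^+ 2.
Proof.
move=> vb; rewrite sqr_enorm; apply: sum_le_const => j.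
rewrite -[_ ^+ 2]real_normK ?num_real // ler_sqr ?nnegrE //.
exact: le_trans (vb j).
Qed.

(** [lam] is the frequency of the torus map; c bounds the squared norm of f'' relative
to |f'|^4. *)
Lemma frequency_exists (c E : R) : 0 <= c -> 0 < E ->
  exists2 lam : R, 1 <= lam & c <= E / 3 * lam ^+ 2.
Proof.
move=> c0 E0; have E3 : 0 < E / 3 by rewrite divr_gt0.
exists (c / (E / 3) + 1); first by rewrite lerDr divr_ge0 // ltW.
set l := _ + 1; have l1 : 1 <= l by rewrite lerDr divr_ge0 // ltW.
have : E / 3 * l = c + E / 3 by rewrite /l mulrDr mulr1 mulrC divfK ?gt_eqF.
have : E / 3 * l <= E / 3 * l ^+ 2.
  by rewrite ler_pM2l // expr2 ler_peMr // (le_trans _ l1).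
lra.
Qed.

(** [del] is the size of the separating map, and [mu] the ratio of the final
homothety. With B a bound for the squared norm of the separating map before its
scaling by [del], the ratio given by mu^2 (1 + del^2 B) = 1 tends to 1 as [del]
tends to 0. *)
Lemma amplitudes_exist (k c B E : R) : 0 <= k -> 0 <= c -> 0 <= B -> 0 < E ->
  exists del mu : R, [/\ 0 < del, 0 < mu, mu ^+ 2 * (1 + del ^+ 2 * B) <= 1 &
    k + E / 3 + del ^+ 2 * c <= (k + E) * mu ^+ 2].
Proof.
move=> k0 c0 B0 E0; pose W := B * (k + E / 3 + c) + c.
have W0 : 0 <= W.
  by rewrite addr_ge0 // mulr_ge0 // addr_ge0 // addr_ge0 // divr_ge0 // ltW.
have D0 : 0 < W + 1 + E by lra.
pose del := (2 * E / 3) / (W + 1 + E).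
have d0 : 0 < del by rewrite divr_gt0 // divr_gt0 // mulr_gt0.
have d1 : del <= 1 by rewrite ler_pdivrMr // mul1r; lra.
have dd : del ^+ 2 <= del by rewrite expr2 ler_piMr // ltW.
have dW : del * W <= 2 * E / 3.
  have : del * (W + 1 + E) = 2 * E / 3 by rewrite divfK // gt_eqF.
  have : del * W <= del * (W + 1 + E) by rewrite ler_pM2l //; lra.
  lra.
have d20 : 0 <= del ^+ 2 := sqr_ge0 _.
have d2B : 0 <= del ^+ 2 * B by rewrite mulr_ge0.
have Q0 : 0 < 1 + del ^+ 2 * B by lra.
exists del, (Num.sqrt (1 + del ^+ 2 * B)^-1); split=> //.
- by rewrite sqrtr_gt0 invr_gt0.
- by rewrite sqr_sqrtr ?invr_ge0 ?(ltW Q0) // mulVf // gt_eqF.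
- rewrite sqr_sqrtr ?invr_ge0 ?(ltW Q0) // ler_pdivlMr //.
  have -> : (k + E / 3 + del ^+ 2 * c) * (1 + del ^+ 2 * B) =
    k + E / 3 + del ^+ 2 * (B * (k + E / 3 + del ^+ 2 * c) + c) by ring.
  have : del ^+ 2 * (B * (k + E / 3 + del ^+ 2 * c) + c) <= del ^+ 2 * W.
    rewrite ler_wpM2l // /W lerD2r ler_wpM2l // lerD2l ler_piMl //.
    exact: le_trans dd d1.
  have : del ^+ 2 * W <= del * W by rewrite ler_wpM2r.
  lra.
Qed.

(** Here e is |f'|^2, and D1, D2 are the squared norms of f'' and of the second
derivative of the separating map. The unit speed condition bounds mu^2 lam^2 e by
1, and the left-hand side is at most k + E times the square of this quantity. *)
Lemma curvature_arith (k E lam del mu e c1 c2 D1 D2 : R) :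
  0 <= k -> 0 < E -> 1 <= lam -> c1 <= E / 3 * lam ^+ 2 -> 0 <= c2 ->
  k + E / 3 + del ^+ 2 * c2 <= (k + E) * mu ^+ 2 ->
  0 <= e -> mu ^+ 2 * (lam ^+ 2 * e) <= 1 ->
  D1 <= c1 * e ^+ 2 -> D2 <= c2 * e ^+ 2 ->
  mu ^+ 2 * (k * (lam ^+ 4 * e ^+ 2) + lam ^+ 2 * D1 + del ^+ 2 * D2) <= k + E.
Proof.
move=> k0 E0 l1 c1l c20 kE e0 mle D1e D2e.
have l20 : 0 <= lam ^+ 2 := sqr_ge0 _.
have l21 : 1 <= lam ^+ 2 by rewrite exprn_ege1.
have m20 : 0 <= mu ^+ 2 := sqr_ge0 _.
have d20 : 0 <= del ^+ 2 := sqr_ge0 _.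
have e20 : 0 <= e ^+ 2 := sqr_ge0 _.
have l41 : 1 <= lam ^+ 4 by rewrite exprn_ege1.
have l40 : 0 <= lam ^+ 4 by exact: le_trans l41.
pose T := lam ^+ 4 * e ^+ 2.
have T0 : 0 <= T by rewrite mulr_ge0.
have h1 : lam ^+ 2 * D1 <= E / 3 * T.
  apply: le_trans (_ : lam ^+ 2 * (c1 * e ^+ 2) <= _); first by rewrite ler_wpM2l.
  have -> : E / 3 * T = lam ^+ 2 * (E / 3 * lam ^+ 2 * e ^+ 2) by rewrite /T; ring.
  by rewrite ler_wpM2l // ler_wpM2r.
have h2 : del ^+ 2 * D2 <= del ^+ 2 * c2 * T.
  rewrite -mulrA ler_wpM2l //; apply: le_trans D2e _; rewrite ler_wpM2l //.
  by rewrite /T ler_peMl.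
apply: le_trans (_ : mu ^+ 2 * ((k + E / 3 + del ^+ 2 * c2) * T) <= _).
  by rewrite ler_wpM2l // -/T; lra.
apply: le_trans (_ : mu ^+ 2 * ((k + E) * mu ^+ 2 * T) <= _).
  by rewrite ler_wpM2l // ler_wpM2r.
have -> : mu ^+ 2 * ((k + E) * mu ^+ 2 * T) =
   (k + E) * (mu ^+ 2 * (lam ^+ 2 * e)) ^+ 2 by rewrite /T; ring.
rewrite -[leRHS]mulr1 ler_wpM2l //; first by lra.
have p0 : 0 <= mu ^+ 2 * (lam ^+ 2 * e) by apply: mulr_ge0 => //; exact: mulr_ge0.
exact: exprn_ile1.
Qed.

End FinalEstimates.

Theorem mainTheorem2 (R : realType) (n m : nat) (X : smoothManifold R n)
    (f : X -> 'rV[R]_m) :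
  closed_manifold X -> smooth_immersion f ->
  forall eps : R, 0 < eps ->
  exists g : X -> 'rV[R]_(16 * m ^ 2 + 16 * m),
    [/\ smooth_immersion g,
        (0 < m)%N -> smooth_embedding g,
        range g `<=` unit_ball R (16 * m ^ 2 + 16 * m) &
        (curv_perp g <= (Num.sqrt ((3 * m%:R) / (m%:R + 2)) + eps)%:E)%E].
Proof.
move=> cX imf eps eps0.
have [m0|m0] := posnP m.
  (* In R^0 there are no unit tangent vectors, and the target has the right dimension. *)
  subst m; exists f; split=> //.
  - by move=> _ [x _ <-]; rewrite /unit_ball /= /enorm big_ord0 sqrtr0.
  - apply: ge_ereal_sup => y [c [p [v [_ _ v1 _]]]].
    by move: v1; rewrite /enorm big_ord0 sqrtr0 => /esym/eqP; rewrite oner_eq0.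
have [N [a [s [NM a1 s2 s4]]]] := fourth_moment_design R m0.
set k := 3 * m%:R / (m%:R + 2) in s4 *.
have k0 : 0 <= k by rewrite divr_ge0 // mulr_ge0.
have [K [H [sH injH]]] := injective_smooth_map cX.
have /smooth_mapP sHc := sH.
have [C CP] := uniform_chart_bounds (H := fun x j => H x 0 j) cX imf sHc.
have [sf _] := imf.
pose E := eps ^+ 2; have E0 : 0 < E by rewrite exprn_gt0.
pose c1 := m%:R * C ^+ 2; have c10 : 0 <= c1 by rewrite mulr_ge0 ?sqr_ge0.
have [lam l1 lP] := frequency_exists c10 E0.
have lam0 : 0 < lam by exact: lt_le_trans l1.
pose Flam (x : X) : 'rV[R]_m := f x *m lam%:M.
have sF : smooth_map Flam by exact: smooth_map_mulmx.
pose Phi := torus_map a s \o Flam.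
have sPhi : smooth_map Phi by exact: smooth_map_torus.
have sf' := (smooth_map_Ck_row f).1 sf; have sF' := (smooth_map_Ck_row Flam).1 sF.
have sH' := (smooth_map_Ck_row H).1 sH; have sPhi' := (smooth_map_Ck_row Phi).1 sPhi.
have elam (w : 'rV[R]_m) : enorm (w *m lam%:M) ^+ 2 = lam ^+ 2 * enorm w ^+ 2.
  by rewrite mul_mx_scalar enormZ gtr0_norm // exprMn.
have elam4 (w : 'rV[R]_m) :
    enorm (w *m lam%:M) ^+ 4 = lam ^+ 4 * (enorm w ^+ 2) ^+ 2.
  have pow4 (y : R) : y ^+ 4 = (y ^+ 2) ^+ 2 by rewrite -exprM.
  by rewrite !pow4 elam exprMn.
have DPhi c q u : atlas c -> chart_cod c q ->
    enorm ('D_u (Phi \o chart_inv c) q) ^+ 2 =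
    lam ^+ 2 * enorm ('D_u (f \o chart_inv c) q) ^+ 2.
  move=> ac cq; rewrite (torus_map_isometric s2 (chart_codO c) cq u (sF' c ac 1%N)).
  by rewrite (derive_mulmx lam%:M u (smooth_map_diff sf ac cq)) elam.
have D2Phi c q u : atlas c -> chart_cod c q ->
    enorm ('D_u ('D_u (Phi \o chart_inv c)) q) ^+ 2 =
    k * (lam ^+ 4 * (enorm ('D_u (f \o chart_inv c) q) ^+ 2) ^+ 2) +
    lam ^+ 2 * enorm ('D_u ('D_u (f \o chart_inv c)) q) ^+ 2.
  move=> ac cq.
  rewrite (torus_map_second_derivative s2 s4 (chart_codO c) cq u (sF' c ac 2%N)).
  have E1 : 'D_u (Flam \o chart_inv c) q = 'D_u (f \o chart_inv c) q *m lam%:M.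
    exact: (derive_mulmx lam%:M u (smooth_map_diff sf ac cq)).
  have E2 : 'D_u ('D_u (Flam \o chart_inv c)) q =
      'D_u ('D_u (f \o chart_inv c)) q *m lam%:M.
    exact: (second_derive_mulmx lam%:M u (chart_codO c) cq (sf' c ac 2%N)).
  by rewrite E1 E2; congr (k * _ + _); [exact: elam4|exact: elam].
have iPhi : smooth_immersion Phi.
  apply: (@immersion_dominated _ _ _ _ _ f Phi (lam ^+ 2)) => //.
    by rewrite exprn_gt0.
  by move=> c q u ac cq; rewrite DPhi.
have [x0|A AP] := @generic_projection _ _ _ cX _ _ (2 * m).+1 Phi H iPhi sH injH.
  by rewrite ltnS leq_mul2l (immersion_dim_le x0 imf).
have [al al0 alP] := enorm_mulmx_le A.
pose c2 := al ^+ 2 * (K%:R * C ^+ 2).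
have c20 : 0 <= c2 by rewrite mulr_ge0 ?sqr_ge0 // mulr_ge0 ?sqr_ge0.
have [B BP] : exists B, forall x, [set: X] x -> enorm (H x *m A) ^+ 2 <= B.
  apply: (compact_uniform (P := fun B x => enorm (H x *m A) ^+ 2 <= B)) cX _ _.
    by move=> b b' x bb /le_trans; exact.
  move=> x _; exists (al ^+ 2 * \sum_j (`|H x 0 j| + 1) ^+ 2).
  have N1 : nbhs x [set y | forall j, `|H y 0 j| < `|H x 0 j| + 1].
    apply: near_forall => j.
    have cn : {for x, continuous (fun y => `|H y 0 j|)}.
      apply: (@continuous_comp _ _ _ (fun y => H y 0 j)); last exact: norm_continuous.
      exact: (smooth_scalar_continuous (sHc j)).
    have lt : `|H x 0 j| < `|H x 0 j| + 1 by rewrite ltrDl.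
    exact: (cn [set t | t < `|H x 0 j| + 1] (open_nbhs_nbhs (conj (@open_lt _ _) lt))).
  apply: filterS N1 => y yP /=.
  apply: le_trans (_ : (al * enorm (H y)) ^+ 2 <= _).
    by rewrite ler_sqr ?nnegrE ?enorm_ge0 // mulr_ge0 // enorm_ge0.
  rewrite exprMn ler_wpM2l ?sqr_ge0 // sqr_enorm; apply: ler_sum => j _.
  rewrite -[_ ^+ 2]real_normK ?num_real // ler_sqr ?nnegrE ?addr_ge0 //.
  exact: ltW (yP j).
(* The pairs of points that A separates depend on lam, and the bounds for the separating
   map depend on A: this dictates the order of the choices. *)
have [del [mu [d0 mu0 muB muE]]] := amplitudes_exist k0 c20 (normr_ge0 B) E0.
pose h (x : X) : 'rV[R]_(2 * m).+1 := H x *m (del *: A).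
have sh : smooth_map h by exact: smooth_map_mulmx.
pose G (x : X) := row_mx (Phi x) (h x).
have sG : smooth_map G by exact: smooth_map_row_mx.
have dimle : (N + N + (2 * m).+1 <= 16 * m ^ 2 + 16 * m)%N.
  exact: coordinate_count.
pose T : 'M[R]_(N + N + (2 * m).+1, 16 * m ^ 2 + 16 * m) := mu *: pid_mx (N + N + (2 * m).+1).
have eT w : enorm (w *m T) = mu * enorm w.
  by rewrite /T -scalemxAr enormZ gtr0_norm // enorm_pid_mx.
pose g (x : X) := G x *m T.
have sg : smooth_map g by exact: smooth_map_mulmx.
have sh' := (smooth_map_Ck_row h).1 sh; have sG' := (smooth_map_Ck_row G).1 sG.
have Dg c q u : atlas c -> chart_cod c q ->
    enorm ('D_u (g \o chart_inv c) q) ^+ 2 = mu ^+ 2 *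
    (lam ^+ 2 * enorm ('D_u (f \o chart_inv c) q) ^+ 2 +
     enorm ('D_u (h \o chart_inv c) q) ^+ 2).
  move=> ac cq.
  have E1 : 'D_u (g \o chart_inv c) q = 'D_u (G \o chart_inv c) q *m T.
    exact: (derive_mulmx T u (smooth_map_diff sG ac cq)).
  have E2 : 'D_u (G \o chart_inv c) q =
      row_mx ('D_u (Phi \o chart_inv c) q) ('D_u (h \o chart_inv c) q).
    exact: (derive_row_mx u (smooth_map_diff sPhi ac cq) (smooth_map_diff sh ac cq)).
  by rewrite E1 eT exprMn E2 sqr_enorm_row_mx DPhi.
have D2g c q u : atlas c -> chart_cod c q ->
    enorm ('D_u ('D_u (g \o chart_inv c)) q) ^+ 2 = mu ^+ 2 *
    (k * (lam ^+ 4 * (enorm ('D_u (f \o chart_inv c) q) ^+ 2) ^+ 2) +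
    lam ^+ 2 * enorm ('D_u ('D_u (f \o chart_inv c)) q) ^+ 2 +
    del ^+ 2 * enorm ('D_u ('D_u (H \o chart_inv c)) q *m A) ^+ 2).
  move=> ac cq.
  have E1 : 'D_u ('D_u (g \o chart_inv c)) q = 'D_u ('D_u (G \o chart_inv c)) q *m T.
    exact: (second_derive_mulmx T u (chart_codO c) cq (sG' c ac 2%N)).
  have E2 : 'D_u ('D_u (G \o chart_inv c)) q =
      row_mx ('D_u ('D_u (Phi \o chart_inv c)) q) ('D_u ('D_u (h \o chart_inv c)) q).
    exact: (second_derive_row_mx u (chart_codO c) cq (sPhi' c ac 2%N) (sh' c ac 2%N)).
  have E3 : 'D_u ('D_u (h \o chart_inv c)) q =
      'D_u ('D_u (H \o chart_inv c)) q *m (del *: A).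
    exact: (second_derive_mulmx (del *: A) u (chart_codO c) cq (sH' c ac 2%N)).
  rewrite E1 eT exprMn E2 sqr_enorm_row_mx D2Phi // E3.
  by rewrite -scalemxAr enormZ gtr0_norm // [(del * _) ^+ 2]exprMn.
have ig : smooth_immersion g.
  apply: (@immersion_dominated _ _ _ _ _ f g (mu ^+ 2 * lam ^+ 2)) => //.
    by rewrite mulr_gt0 // exprn_gt0.
  move=> c q u ac cq; rewrite Dg // mulrDr mulrA lerDl.
  by rewrite mulr_ge0 // sqr_ge0.
exists g; split=> //.
- move=> _; apply: injective_immersion_embedding => // x y gxy.
  have : (G x - G y) *m T = 0 by rewrite mulmxBl; apply/eqP; rewrite subr_eq0; apply/eqP.
  move=> /(congr1 (@enorm _ _)); rewrite eT enorm0 => /eqP.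
  rewrite mulf_eq0 gt_eqF //= => /eqP /enorm0_eq0 /eqP; rewrite subr_eq0 => /eqP.
  move=> /eq_row_mx [Pxy hxy]; apply: AP => //.
  move: hxy; rewrite /h -!scalemxAr => /(scalerI _); apply.
  by rewrite gt_eqF.
- move=> _ [x _ <-]; rewrite /unit_ball /= enorm_le // expr1n -sqr_enorm eT exprMn.
  rewrite sqr_enorm_row_mx enorm_torus_map // expr1n /h -scalemxAr enormZ gtr0_norm //.
  rewrite exprMn; apply: le_trans muB; rewrite ler_wpM2l ?sqr_ge0 // lerD2l.
  by rewrite ler_wpM2l ?sqr_ge0 // (le_trans (BP x _)) // ler_norm.
- apply: curv_perp_le => // x; have [d [ad dx bound]] := CP x; exists d => //.
  split=> // u; set q := chart_map d x => g1.
  have cq : chart_cod d q by exact: chart_map_cod.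
  have [bf bH] := bound u; rewrite -/q in bf bH.
  set e := enorm ('D_u (f \o chart_inv d) q) ^+ 2 in bf bH.
  rewrite enorm_le ?addr_ge0 ?sqrtr_ge0 ?(ltW eps0) // -sqr_enorm.
  apply: le_trans (_ : k + E <= _); last first.
    rewrite sqrrD sqr_sqrtr // /E lerD2r lerDl mulrn_wge0 //.
    by rewrite mulr_ge0 ?sqrtr_ge0 // ltW.
  rewrite D2g // -/e; apply: (curvature_arith (c1 := c1) (c2 := c2)) => //.
  + exact: sqr_ge0.
  + have := Dg d q u ad cq; rewrite g1 expr1n -/e => ->.
    by rewrite ler_wpM2l ?sqr_ge0 // lerDl sqr_ge0.
  + rewrite /c1 -mulrA -exprMn; apply: sqr_enorm_le_coord => j.
    rewrite (second_derive_row u u j (chart_codO d) cq (sf' d ad 2%N)).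
    exact: bf.
  + apply: le_trans (_ : (al * enorm ('D_u ('D_u (H \o chart_inv d)) q)) ^+ 2 <= _).
      by rewrite ler_sqr ?nnegrE ?enorm_ge0 // mulr_ge0 // enorm_ge0.
    rewrite /c2 exprMn -mulrA ler_wpM2l ?sqr_ge0 // -mulrA -exprMn.
    apply: sqr_enorm_le_coord => j.
    rewrite (second_derive_row u u j (chart_codO d) cq (sH' d ad 2%N)).
    exact: bH.
Qed.
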